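(* Let $A$ be a normal integral $k$-algebra of finite type over an algebraically closed field $k$ of characteristic $p>0$. Let $B$ be a normal $k$-subalgebra of $A$ such that $A^p\subseteq B\subseteq A$. Then the kernel of the pull-back morphism $\pi: Pic(B)\to Pic(A)$, $M\mapsto M\otimes_B A$, is a finite $\mathbb{F}_p$-vector space, and $$\dim_{\mathbb{F}_p}\ker\pi\leq\dim_{\mathbb{F}_p}\Pi(A,\mathcal{F}_B).$$ In particular, if $A$ is a UFD, then the Picard group of $B$ is finite.
   Context: ''Integral'' means that the (commutative) ring is an integral domain; $K(A)$ denotes the fraction field of $A$; $A^p=\{a^p\mid a\in A\}$. $Der_k(A)$ is the set of $k$-derivations $A\to A$; each such derivation extends uniquely to $K(A)$. $\mathcal{F}_B$ is the set of $k$-derivations on $A$ which vanish on $B$. For $\mathcal{D}\subseteq Der_k(A)$, an element $f\in K(A)^*$ is an algebraic solution of $\mathcal{D}$ if $D(f)/f\in A$ for every $D\in\mathcal{D}$, and a first integral of $\mathcal{D}$ if $D(f)=0$ for every $D\in\mathcal{D}$. Both sets are multiplicative subgroups of $K(A)^*$, and $\Pi(A,\mathcal{D})=\{\text{algebraic solutions of }\mathcal{D}\}/\{\text{first integrals of }\mathcal{D}\}$, which is an $\mathbb{F}_p$-vector space because $D(f^p)=0$ for all $f\in K(A)$. *)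

(* Defs.v *)
From HB Require Import structures.
From mathcomp Require Import all_boot all_order all_algebra.
From mathcomp Require Import ring.
From mathcomp Require Import generic_quotient.
From mathcomp Require Import boolp classical_sets cardinality.

Set Implicit Arguments.
Unset Strict Implicit.
Unset Printing Implicit Defensive.

Import GRing.Theory.

Local Open Scope classical_set_scope.
Local Open Scope ring_scope.
Local Open Scope quotient_scope.

#[short(type="idomainAlgType")]
HB.structure Definition IdomainAlgebra (R : nzRingType) :=
  {A of GRing.IntegralDomain A & GRing.ComAlgebra R A}.

Definition finite_type_alg (k : fieldType) (A : comAlgType k) : Prop :=
  exists s : seq A, forall S : subalgClosed A,
    {subset s <= S} -> forall a : A, a \in S.

Definition normal_domain (R : idomainType) : Prop :=
  forall x : {fraction R},
    integralOver (@tofrac R) x -> exists a : R, x = tofrac a.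

Section UFD.
Variable R : idomainType.

Definition irreducible_elt (x : R) : Prop :=
  [/\ x != 0, x \isn't a GRing.unit &
    forall y z : R, x = y * z -> y \is a GRing.unit \/ z \is a GRing.unit].

Definition associated (x y : R) : Prop :=
  exists2 u : R, u \is a GRing.unit & y = u * x.

Definition ufd : Prop :=
  (forall x : R, x != 0 -> x \isn't a GRing.unit ->
     exists s : seq R, (forall y, y \in s -> irreducible_elt y) /\
                       x = \prod_(y <- s) y) /\
  (forall s t : seq R,
     (forall y, y \in s -> irreducible_elt y) ->
     (forall y, y \in t -> irreducible_elt y) ->
     \prod_(y <- s) y = \prod_(y <- t) y ->
     size s = size t /\
     exists2 t' : seq R, perm_eq t' t &
       forall i : nat, (i < size s)%N -> associated s`_i t'`_i).

End UFD.

(* A subalgebra as an integral domain in its own right.  Its units are the     *)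
(* elements invertible inside B, not merely in A.                              *)
Section Subalgebra.
Variables (k : fieldType) (A : idomainAlgType k) (B : subalgClosed A).

Record subalg := Subalg { subalg_val :> A; subalg_valP : subalg_val \in B }.

HB.instance Definition _ := [isSub for subalg_val].
HB.instance Definition _ := [Choice of subalg by <:].
HB.instance Definition _ :=
  GRing.SubChoice_isSubComNzRing.Build A [in B] subalg
    (GRing.subalg_closedBM (GRing.subalgClosedP B)).

Definition subalg_unit : {pred subalg} :=
  [pred x | (subalg_val x \is a GRing.unit) && ((subalg_val x)^-1 \in B)].

Definition subalg_inv (x : subalg) : subalg := insubd x (subalg_val x)^-1.

Fact subalg_mulVx : {in subalg_unit, left_inverse 1 subalg_inv *%R}.
Proof.
move=> x /andP[ux Bx]; apply: val_inj.
by rewrite rmorphM rmorph1 /= /subalg_inv insubdK // mulVr.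
Qed.

Fact subalg_unitPl (x y : subalg) : y * x = 1 -> subalg_unit x.
Proof.
move=> /(congr1 val); rewrite rmorphM rmorph1 /= => yx1.
have ux : subalg_val x \is a GRing.unit.
  by apply/unitrP; exists (val y); split=> //; rewrite mulrC.
apply/andP; split=> //.
rewrite -[_^-1]mul1r -yx1 -mulrA divrr // mulr1; exact: valP.
Qed.

Fact subalg_inv_out : {in [predC subalg_unit], subalg_inv =1 id}.
Proof.
move=> x; rewrite !inE negb_and /subalg_inv.
have [ux /= nBx|nux _] := boolP (subalg_val x \is a GRing.unit).
  by apply: val_inj; rewrite val_insubd (negPf nBx).
by rewrite invr_out //; apply: val_inj; rewrite val_insubd subalg_valP.
Qed.

HB.instance Definition _ := GRing.ComNzRing_hasMulInverse.Build subalg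
  subalg_mulVx subalg_unitPl subalg_inv_out.

Fact subalg_integral : GRing.integral_domain_axiom subalg.
Proof.
move=> x y /(congr1 val) /eqP; rewrite rmorphM rmorph0 /= mulf_eq0.
by case/orP=> /eqP h; apply/orP; [left|right]; apply/eqP/val_inj; rewrite /= h.
Qed.

HB.instance Definition _ :=
  GRing.ComUnitRing_isIntegral.Build subalg subalg_integral.

Definition subalg_incl : {rmorphism subalg -> A} := val : {rmorphism subalg -> A}.

End Subalgebra.

Definition lmod_iso (R : comNzRingType) (M N : lmodType R) : Prop :=
  exists f : {linear M -> N}, bijective f.

(* The free commutative monoid on the symbols m (x) n (finite formal sums),    *)
(* modulo the congruence generated by the bilinearity relations.  Opposites    *)
(* then exist, since (- m) (x) n is opposite to m (x) n.                       *)
Inductive tens_rel (R : comNzRingType) (M N : lmodType R) :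
    seq (M * N) -> seq (M * N) -> Prop :=
| TensRefl s : tens_rel s s
| TensSym s t : tens_rel s t -> tens_rel t s
| TensTrans s t u : tens_rel s t -> tens_rel t u -> tens_rel s u
| TensCat s s' t t' :
    tens_rel s s' -> tens_rel t t' -> tens_rel (s ++ t) (s' ++ t')
| TensComm s t : tens_rel (s ++ t) (t ++ s)
| TensZero n : tens_rel [:: (0, n)] [::]
| TensAddl m m' n : tens_rel [:: (m + m', n)] [:: (m, n); (m', n)]
| TensAddr m n n' : tens_rel [:: (m, n + n')] [:: (m, n); (m, n')]
| TensScale (a : R) m n : tens_rel [:: (a *: m, n)] [:: (m, a *: n)].

Section Tensor.
Variables (R : comNzRingType) (M N : lmodType R).

Definition tens_relb (s t : seq (M * N)) : bool := `[< tens_rel s t >].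

Fact tens_relb_equiv : equiv_class_of tens_relb.
Proof.
split=> [s|s t|t s u]; first by apply/asboolP; exact: TensRefl.
  by apply/asboolP/asboolP; exact: TensSym.
by move=> /asboolP st /asboolP tu; apply/asboolP; exact: TensTrans tu.
Qed.

Canonical tens_equiv := EquivRelPack tens_relb_equiv.

Definition tens := {eq_quot tens_relb}.

HB.instance Definition _ : EqQuotient _ tens_relb tens := EqQuotient.on tens.
HB.instance Definition _ := Choice.on tens.

Definition tens_pi (s : seq (M * N)) : tens := \pi_tens s.

Lemma tens_piP s t : tens_pi s = tens_pi t <-> tens_rel s t.
Proof.
split=> [/eqP|st]; first by rewrite /tens_pi eqmodE => /asboolP.
by apply/eqP; rewrite /tens_pi eqmodE; apply/asboolP.
Qed.

Lemma tens_repr s : tens_rel (repr (tens_pi s)) s.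
Proof. by apply/tens_piP; rewrite /tens_pi reprK. Qed.

Lemma tens_piK x : tens_pi (repr x) = x.
Proof. exact: reprK. Qed.

Definition scale_pair (a : R) (mn : M * N) : M * N := (a *: mn.1, mn.2).

Definition tens_add (x y : tens) : tens := tens_pi (repr x ++ repr y).
Definition tens_scale (a : R) (x : tens) : tens :=
  tens_pi (map (scale_pair a) (repr x)).

Lemma tens_rel_scale a s t : tens_rel s t ->
  tens_rel (map (scale_pair a) s) (map (scale_pair a) t).
Proof.
elim=> [{}s|{}s {}t _|{}s {}t u _ st _|{}s s' {}t t' _ h1 _|{}s {}t|n|m m' n
       |m n n'|b m n] /=.
- exact: TensRefl.
- exact: TensSym.
- exact: TensTrans st.
- by rewrite !map_cat; exact: TensCat.
- by rewrite !map_cat; exact: TensComm.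
- by rewrite /scale_pair /= scaler0; exact: TensZero.
- by rewrite /scale_pair /= scalerDr; exact: TensAddl.
- exact: TensAddr.
- by rewrite /scale_pair /= scalerA mulrC -scalerA; exact: TensScale.
Qed.

Lemma tens_pi_cat s t : tens_pi (s ++ t) = tens_add (tens_pi s) (tens_pi t).
Proof.
by apply/tens_piP; apply: TensCat; apply: TensSym; apply: tens_repr.
Qed.

Lemma tens_pi_scale a s :
  tens_scale a (tens_pi s) = tens_pi (map (scale_pair a) s).
Proof. by apply/tens_piP/tens_rel_scale/tens_repr. Qed.

Fact tens_addA : associative tens_add.
Proof.
move=> x y z; rewrite -(tens_piK x) -(tens_piK y) -(tens_piK z).
by rewrite -!tens_pi_cat catA.
Qed.

Fact tens_addC : commutative tens_add.
Proof. by move=> x y; apply/tens_piP; apply: TensComm. Qed.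

Fact tens_add0 : left_id (tens_pi [::]) tens_add.
Proof. by move=> x; rewrite -(tens_piK x) -tens_pi_cat. Qed.

HB.instance Definition _ :=
  GRing.isNmodule.Build tens tens_addA tens_addC tens_add0.

Lemma tens_pi0 : tens_pi [::] = 0.
Proof. by []. Qed.

Lemma tens_piD s t : tens_pi (s ++ t) = tens_pi s + tens_pi t.
Proof. exact: tens_pi_cat. Qed.

Lemma tens_pi_cons mn s : tens_pi (mn :: s) = tens_pi [:: mn] + tens_pi s.
Proof. by rewrite -cat1s tens_piD. Qed.

Lemma tens_pi1Dl m m' n :
  tens_pi [:: (m + m', n)] = tens_pi [:: (m, n)] + tens_pi [:: (m', n)].
Proof. by rewrite -tens_piD; apply/tens_piP; apply: TensAddl. Qed.

Fact tens_addN : left_inverse 0 (tens_scale (-1)) +%R.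
Proof.
move=> x; rewrite -(tens_piK x) tens_pi_scale.
elim: (repr x) => [|[m n] s IHs]; first by rewrite /= tens_pi0 addr0.
rewrite map_cons (tens_pi_cons (m, n) s) (tens_pi_cons (scale_pair _ _)) addrACA IHs addr0.
rewrite /scale_pair /= -tens_pi1Dl scaleN1r addNr.
exact/tens_piP/TensZero.
Qed.

HB.instance Definition _ := GRing.Nmodule_isZmodule.Build tens tens_addN.

Fact tens_scaleA a b (x : tens) :
  tens_scale a (tens_scale b x) = tens_scale (a * b) x.
Proof.
rewrite -(tens_piK x) !tens_pi_scale -map_comp; congr tens_pi.
by apply: eq_map => mn; rewrite /scale_pair /= scalerA.
Qed.

Fact tens_scale1 : left_id 1 tens_scale.
Proof.
move=> x; rewrite -(tens_piK x) tens_pi_scale; congr tens_pi.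
by rewrite -[RHS]map_id; apply: eq_map => -[m n]; rewrite /scale_pair /= scale1r.
Qed.

Fact tens_scaleDr : right_distributive tens_scale +%R.
Proof.
move=> a x y; rewrite -(tens_piK x) -(tens_piK y) -tens_piD.
by rewrite !tens_pi_scale map_cat tens_piD.
Qed.

Fact tens_scaleDl (x : tens) : {morph tens_scale^~ x : a b / a + b}.
Proof.
move=> a b; rewrite -(tens_piK x) !tens_pi_scale.
elim: (repr x) => [|[m n] s IHs]; first by rewrite /= tens_pi0 addr0.
rewrite !map_cons (tens_pi_cons (scale_pair (a + b) _)) IHs.
rewrite (tens_pi_cons (scale_pair a _)) (tens_pi_cons (scale_pair b _)).
rewrite addrACA; congr (_ + _).
by rewrite /scale_pair /= scalerDl tens_pi1Dl.
Qed.

HB.instance Definition _ := GRing.Zmodule_isLmodule.Build R tens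
  tens_scaleA tens_scale1 tens_scaleDr tens_scaleDl.

Definition pure (m : M) (n : N) : tens := tens_pi [:: (m, n)].

Lemma tens_ind (P : tens -> Prop) :
  (forall m n, P (pure m n)) -> (forall x y, P x -> P y -> P (x + y)) ->
  forall x, P x.
Proof.
move=> Ppure PD x; rewrite -(tens_piK x).
elim: (repr x) => [|[m n] s IHs].
  suff -> : tens_pi [::] = pure 0 0 by apply: Ppure.
  by apply/tens_piP/TensSym/TensZero.
by rewrite tens_pi_cons; apply: PD IHs; apply: Ppure.
Qed.

Lemma pureDl m m' n : pure (m + m') n = pure m n + pure m' n.
Proof. exact: tens_pi1Dl. Qed.

Lemma pureDr m n n' : pure m (n + n') = pure m n + pure m n'.
Proof. by rewrite -tens_piD; apply/tens_piP/TensAddr. Qed.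

Lemma pureZl a m n : pure (a *: m) n = a *: pure m n.
Proof. by rewrite -[RHS]/(tens_scale _ _) tens_pi_scale. Qed.

Lemma pureZr a m n : pure m (a *: n) = a *: pure m n.
Proof. by rewrite -pureZl; apply/tens_piP/TensSym/TensScale. Qed.

Lemma tens_sum (x : tens) : x = \sum_(mn <- repr x) pure mn.1 mn.2.
Proof.
rewrite -{1}(tens_piK x); elim: (repr x) => [|[m n] s IHs].
  by rewrite big_nil.
by rewrite big_cons tens_pi_cons IHs.
Qed.

Section Lift.
Variables (P : lmodType R) (f : M -> N -> P).

Definition bilin : Prop :=
  [/\ forall m m' n, f (m + m') n = f m n + f m' n,
      forall m n n', f m (n + n') = f m n + f m n',
      forall a m n, f (a *: m) n = a *: f m n &
      forall a m n, f m (a *: n) = a *: f m n].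

Hypothesis bf : bilin.

Definition tens_lift_fun (x : tens) : P := \sum_(mn <- repr x) f mn.1 mn.2.

Lemma tens_rel_sum s t : tens_rel s t ->
  \sum_(mn <- s) f mn.1 mn.2 = \sum_(mn <- t) f mn.1 mn.2.
Proof.
have [fDl fDr fZl fZr] := bf.
elim=> [//|//|{}s {}t u _ -> _ -> //|{}s s' {}t t' _ h _ h'|{}s {}t|n|m m' n
       |m n n'|b m n] /=.
- by rewrite !big_cat h h'.
- by rewrite !big_cat /= addrC.
- by rewrite big_seq1 big_nil /= -(scale0r (0 : M)) fZl scale0r.
- by rewrite !(big_cons, big_nil) /= !addr0.
- by rewrite !(big_cons, big_nil) /= !addr0.
- by rewrite !big_seq1 /= fZl fZr.
Qed.

Lemma tens_lift_pi s : tens_lift_fun (tens_pi s) = \sum_(mn <- s) f mn.1 mn.2.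
Proof. exact/tens_rel_sum/tens_repr. Qed.

Fact tens_lift_linear : linear tens_lift_fun.
Proof.
have [_ _ fZl _] := bf.
move=> a x y; rewrite -(tens_piK x) -(tens_piK y).
rewrite -[a *: _]/(tens_scale _ _) tens_pi_scale -tens_piD.
rewrite !tens_lift_pi big_cat big_map scaler_sumr /=; congr (_ + _).
by apply: eq_bigr => mn _; rewrite fZl.
Qed.

HB.instance Definition _ :=
  GRing.isLinear.Build R tens P *:%R tens_lift_fun tens_lift_linear.

Definition tens_lift : {linear tens -> P} := tens_lift_fun.

Lemma tens_liftE m n : tens_lift (pure m n) = f m n.
Proof. by rewrite [LHS]tens_lift_pi big_seq1. Qed.

End Lift.

End Tensor.
Section LinearOf.
Variables (R : comNzRingType) (M N : lmodType R) (f : M -> N).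
Hypothesis lf : linear f.

Definition linear_of_fun of linear f : M -> N := f.

HB.instance Definition _ :=
  GRing.isLinear.Build R M N *:%R (linear_of_fun lf) lf.

Definition linear_of : {linear M -> N} := linear_of_fun lf.

End LinearOf.

Section Isomorphisms.
Variable R : comNzRingType.
Implicit Types M N L : lmodType R.

Lemma lmod_iso_refl M : lmod_iso M M.
Proof. by exists (@idfun M); exists id. Qed.

Lemma lmod_iso_sym M N : lmod_iso M N -> lmod_iso N M.
Proof.
case=> f [g fK gK].
have lg : linear g.
  by move=> a x y; apply: (can_inj fK); rewrite linearP !gK.
by exists (linear_of lg); exists f.
Qed.

Lemma lmod_iso_trans M N L : lmod_iso M N -> lmod_iso N L -> lmod_iso M L.
Proof.
by case=> f bf [g bg]; exists (g \o f); apply: bij_comp.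
Qed.

Lemma tens_isoC M N : lmod_iso (tens M N) (tens N M).
Proof.
have b M' N' : bilin (fun (m : M') (n : N') => pure n m).
  by split=> *; rewrite (pureDl, pureDr, pureZl, pureZr).
exists (tens_lift (b M N)); exists (tens_lift (b N M)).
  by elim/tens_ind=> [m n|x y IHx IHy]; rewrite ?tens_liftE // !linearD IHx IHy.
by elim/tens_ind=> [m n|x y IHx IHy]; rewrite ?tens_liftE // !linearD IHx IHy.
Qed.

Section Map.
Variables (M N M' N' : lmodType R) (f : {linear M -> M'}) (g : {linear N -> N'}).

Fact tens_map_bilin : bilin (fun m n => pure (f m) (g n)).
Proof.
by split=> *; rewrite !(linearD, linearZ) /= (pureDl, pureDr, pureZl, pureZr).
Qed.

Definition tens_map : {linear tens M N -> tens M' N'} :=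
  tens_lift tens_map_bilin.

Lemma tens_mapE m n : tens_map (pure m n) = pure (f m) (g n).
Proof. exact: tens_liftE. Qed.

End Map.

Lemma tens_iso M N M' N' :
  lmod_iso M M' -> lmod_iso N N' -> lmod_iso (tens M N) (tens M' N').
Proof.
have inv (P Q : lmodType R) (f : {linear P -> Q}) : bijective f ->
    exists g : {linear Q -> P}, cancel f g /\ cancel g f.
  case=> g fK gK; have lg : linear g.
    by move=> a x y; apply: (can_inj fK); rewrite linearP !gK.
  by exists (linear_of lg).
case=> f /inv[f' [fK f'K]] [g /inv[g' [gK g'K]]].
exists (tens_map f g); exists (tens_map f' g').
  elim/tens_ind=> [m n|x y IHx IHy]; last by rewrite !linearD IHx IHy.
  by rewrite !tens_mapE fK gK.
elim/tens_ind=> [m n|x y IHx IHy]; last by rewrite !linearD IHx IHy.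
by rewrite !tens_mapE f'K g'K.
Qed.

Lemma tens_iso1 M : lmod_iso (tens R^o M) M.
Proof.
have b : bilin (fun (a : R^o) (m : M) => a *: m).
  split=> [a a' m|a m m'|a b m|a b m].
  - exact: scalerDl.
  - exact: scalerDr.
  - by rewrite scalerA.
  - by rewrite !scalerA mulrC.
exists (tens_lift b); exists (pure (1 : R^o)).
  elim/tens_ind=> [a m|x y IHx IHy]; last by rewrite linearD pureDr IHx IHy.
  by rewrite tens_liftE pureZr -pureZl; congr pure; exact: mulr1.
by move=> m; rewrite tens_liftE scale1r.
Qed.

Lemma lift_bilin M N L (P : lmodType R) (f : L -> M -> N -> P) (bf : forall l, bilin (f l)) :
  (forall l l' m n, f (l + l') m n = f l m n + f l' m n) ->
  (forall a l m n, f (a *: l) m n = a *: f l m n) ->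
  bilin (fun x l => tens_lift (bf l) x).
Proof.
move=> fD fZ; split=> [x y l|x l l'|a x l|a x l]; rewrite ?linearD ?linearZ //.
  elim/tens_ind: x => [m n|x y IHx IHy]; first by rewrite !tens_liftE.
  by rewrite !linearD IHx IHy addrACA.
elim/tens_ind: x => [m n|x y IHx IHy]; first by rewrite !tens_liftE.
by rewrite !linearD IHx IHy.
Qed.

Lemma bilin_flip M N (P : lmodType R) (f : M -> N -> P) :
  bilin f -> bilin (fun n m => f m n).
Proof. by case=> fDl fDr fZl fZr; split=> *; rewrite ?(fDl, fDr, fZl, fZr). Qed.

Lemma tens_isoA M N L :
  lmod_iso (tens (tens M N) L) (tens M (tens N L)).
Proof.
have b1 (l : L) : bilin (fun (m : M) (n : N) => pure m (pure n l)).
  by split=> *; rewrite ?(pureDl, pureDr, pureZl, pureZr).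
have b2 (m : M) : bilin (fun (n : N) (l : L) => pure (pure m n) l).
  by split=> *; rewrite ?(pureDl, pureDr, pureZl, pureZr).
have B1 : bilin (fun x l => tens_lift (b1 l) x).
  by apply: lift_bilin => *; rewrite ?(pureDr, pureZr).
have B2 : bilin (fun m y => tens_lift (b2 m) y).
  by apply/bilin_flip/lift_bilin => *; rewrite ?(pureDl, pureZl).
exists (tens_lift B1); exists (tens_lift B2).
  elim/tens_ind=> [x l|x y IHx IHy]; last by rewrite !linearD IHx IHy.
  elim/tens_ind: x => [m n|x y IHx IHy]; first by rewrite !tens_liftE.
  by rewrite pureDl !linearD IHx IHy.
elim/tens_ind=> [m x|x y IHx IHy]; last by rewrite !linearD IHx IHy.
elim/tens_ind: x => [n l|x y IHx IHy]; first by rewrite !tens_liftE.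
by rewrite pureDr !linearD IHx IHy.
Qed.

End Isomorphisms.

Definition invertible (R : comNzRingType) (M : lmodType R) : Prop :=
  exists N : lmodType R, lmod_iso (tens M N) R^o.

(* Modules of type lmodType R form a proper class (a larger universe), so an   *)
(* isomorphism class is coded by a small object: the set of all pairs (n, K)   *)
(* such that M is isomorphic to R^n / K.  Invertible modules are finitely      *)
(* generated, so this set determines them up to isomorphism (iso_classP).      *)
Definition presentation (R : comNzRingType) : Type :=
  {n : nat & set 'rV[R]_n}.

Definition presents (R : comNzRingType) (c : presentation R) (M : lmodType R) :
    Prop :=
  exists f : {linear 'rV[R]_(projT1 c) -> M},
    (forall y, exists x, f x = y) /\ (forall x, projT2 c x <-> f x = 0).

Definition iso_class (R : comNzRingType) (M : lmodType R) :
    set (presentation R) :=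
  [set c | presents c M].

Section Invertible.
Variable R : comNzRingType.
Implicit Types M N : lmodType R.

Lemma invertible1 : invertible (R^o : lmodType R).
Proof. by exists R^o; exact: tens_iso1. Qed.

Lemma invertible_tens M N : invertible M -> invertible N -> invertible (tens M N).
Proof.
case=> M' hM [N' hN]; exists (tens M' N').
apply: (lmod_iso_trans (tens_isoA _ _ _)).
have h : lmod_iso (tens N (tens M' N')) (tens M' (tens N N')).
  apply: (lmod_iso_trans (lmod_iso_sym (tens_isoA _ _ _))).
  apply: (lmod_iso_trans (tens_iso (tens_isoC _ _) (lmod_iso_refl _))).
  exact: tens_isoA.
apply: (lmod_iso_trans (tens_iso (lmod_iso_refl _) h)).
apply: (lmod_iso_trans (lmod_iso_sym (tens_isoA _ _ _))).
apply: (lmod_iso_trans (tens_iso hM hN)); exact: tens_iso1.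
Qed.

Lemma invertible_inv M N : lmod_iso (tens M N) R^o -> invertible N.
Proof. by move=> h; exists M; apply: lmod_iso_trans h; exact: tens_isoC. Qed.

Lemma invertible_presented M : invertible M -> exists c, presents c M.
Proof.
case=> N [f [g fK gK]].
have [t ft] : exists t, f t = 1 by exists (g 1); rewrite gK.
have f_inj := can_inj fK.
have bF : bilin (fun (z : tens M N) (y : M) => f z *: y).
  split=> [z z' y|z y y'|a z y|a z y].
  - by rewrite linearD scalerDl.
  - by rewrite scalerDr.
  - by rewrite linearZ /= -scalerA.
  - by rewrite !scalerA mulrC.
have bg (y : M) : bilin (fun (m : M) (n : N) => f (pure y n) *: m).
  split=> [m m' n|m n n'|a m n|a m n].
  - by rewrite scalerDr.
  - by rewrite pureDr linearD scalerDl.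
  - by rewrite !scalerA mulrC.
  - by rewrite pureZr linearZ /= -scalerA.
have bG : bilin (fun z y => tens_lift (bg y) z).
  apply: lift_bilin => [y y' m n|a y m n].
    by rewrite pureDl linearD scalerDl.
  by rewrite pureZl linearZ /= -scalerA.
pose F := tens_lift bF; pose G := tens_lift bG.
have tF w : pure t (F w) = w.
  elim/tens_ind: w => [z y|x y IHx IHy]; last by rewrite linearD pureDr IHx IHy.
  rewrite tens_liftE pureZr -pureZl; congr pure.
  by apply: f_inj; rewrite linearZ ft; exact: mulr1.
have Gsurj y : exists w, G w = y.
  exists (\sum_(mn <- repr t) pure (pure y mn.2) mn.1).
  rewrite linear_sum.
  under eq_bigr => mn _ do rewrite !tens_liftE.
  rewrite -scaler_suml; have -> : \sum_(mn <- repr t) f (pure mn.1 mn.2) = f t.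
    by rewrite [in RHS](tens_sum t) linear_sum.
  by rewrite ft scale1r.
pose s := repr t; pose n := size s.
pose h (c : 'rV[R]_n) : M := \sum_(i < n) c 0 i *: (nth (0, 0) s i).1.
have lh : linear h.
  move=> a c c'; rewrite /h scaler_sumr -big_split /=.
  by apply: eq_bigr => i _; rewrite !mxE scalerDl scalerA.
exists (existT _ n [set c : 'rV[R]_n | h c = 0]), (linear_of lh); split=> // y.
have [w Gw] := Gsurj y.
exists (\row_i f (pure (F w) (nth (0, 0) s i).2)).
have -> : y = tens_lift (bg (F w)) t by rewrite -Gw -[in LHS](tF w) tens_liftE.
rewrite [RHS]/(tens_lift_fun _ _) /tens_lift_fun.
rewrite (big_nth (0, 0)) big_mkord.
by apply: eq_bigr => i _; rewrite mxE.
Qed.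

Lemma presents_iso c M N : lmod_iso M N -> presents c M -> presents c N.
Proof.
case=> f [g fK gK] [h [hs hk]]; exists (f \o h); split=> [y|x].
  by have [x hx] := hs (g y); exists x; rewrite /= hx.
rewrite hk /=; split=> [->|/eqP]; first exact: linear0.
by rewrite -(linear0 f) => /eqP /(can_inj fK).
Qed.

Lemma iso_classP M N : invertible M ->
  iso_class M = iso_class N <-> lmod_iso M N.
Proof.
move=> iM; split=> [MN|h]; last first.
  apply/seteqP; split=> c /=; apply: presents_iso => //; exact: lmod_iso_sym.
have [c cM] := invertible_presented iM.
have cN : presents c N by rewrite -[presents c N]/(iso_class N c) -MN.
case: cM cN => f [fs fk] [g [gs gk]].
have fg x y : f x = f y <-> g x = g y.
  split=> /eqP; rewrite -subr_eq0 -linearB => /eqP.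
    by move=> /fk /gk /eqP; rewrite linearB subr_eq0 => /eqP.
  by move=> /gk /fk /eqP; rewrite linearB subr_eq0 => /eqP.
pose u (y : M) : 'rV[R]_(projT1 c) := projT1 (cid (fs y)).
pose v (y : N) : 'rV[R]_(projT1 c) := projT1 (cid (gs y)).
have fu y : f (u y) = y by rewrite /u; case: cid.
have gv y : g (v y) = y by rewrite /v; case: cid.
have lgu : linear (g \o u).
  by move=> a x y; rewrite /= -linearP; apply/fg; rewrite linearP !fu.
exists (linear_of lgu); exists (f \o v) => y.
  by rewrite /= -[RHS]fu; apply/fg; rewrite gv.
by rewrite /= -[RHS]gv; apply/fg; rewrite fu.
Qed.

End Invertible.

Section Pic.
Variable R : comNzRingType.

Record pic := PicOfClass {
  pic_class : set (presentation R);
  pic_classP : exists2 M : lmodType R, invertible M & pic_class = iso_class M }.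

HB.instance Definition _ := gen_eqMixin pic.
HB.instance Definition _ := gen_choiceMixin pic.

Definition pic_of (M : lmodType R) (iM : invertible M) : pic :=
  PicOfClass (ex_intro2 _ _ M iM erefl).

Definition pic_repr (x : pic) : lmodType R := projT1 (cid2 (pic_classP x)).

Lemma pic_repr_inv x : invertible (pic_repr x).
Proof. by rewrite /pic_repr; case: cid2. Qed.

Lemma pic_ofP (M N : lmodType R) (iM : invertible M) (iN : invertible N) :
  pic_of iM = pic_of iN <-> lmod_iso M N.
Proof.
split=> [[/(iso_classP _ iM)]//|/(iso_classP _ iM) h].
have ext (x y : pic) : pic_class x = pic_class y -> x = y.
  case: x y => [X hX] [Y hY] /= XY; case: _ / XY hY => hY.
  by rewrite (Prop_irrelevance hX hY).
exact: ext.
Qed.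

Lemma pic_reprK x : pic_of (pic_repr_inv x) = x.
Proof.
case: x => X hX; have : X = iso_class (pic_repr (PicOfClass hX)).
  by rewrite /pic_repr; case: cid2.
set M := pic_repr _; move: (pic_repr_inv _) => iM XM.
rewrite /pic_of; move: (ex_intro2 _ _ _ _ _); rewrite -/M -XM => hX'.
by rewrite (Prop_irrelevance hX hX').
Qed.

Definition pic_add (x y : pic) : pic :=
  pic_of (invertible_tens (pic_repr_inv x) (pic_repr_inv y)).

Definition pic_zero : pic := pic_of (invertible1 R).

Definition pic_opp (x : pic) : pic :=
  pic_of (invertible_inv (projT2 (cid (pic_repr_inv x)))).

Lemma pic_addE (M N : lmodType R) (iM : invertible M) (iN : invertible N) :
  pic_add (pic_of iM) (pic_of iN) = pic_of (invertible_tens iM iN).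
Proof.
by apply/pic_ofP/tens_iso; apply/(pic_ofP (pic_repr_inv _)); rewrite pic_reprK.
Qed.

Fact pic_addA : associative pic_add.
Proof.
move=> x y z; rewrite -(pic_reprK x) -(pic_reprK y) -(pic_reprK z) !pic_addE.
by apply/pic_ofP/lmod_iso_sym/tens_isoA.
Qed.

Fact pic_addC : commutative pic_add.
Proof. by move=> x y; apply/pic_ofP/tens_isoC. Qed.

Fact pic_add0 : left_id pic_zero pic_add.
Proof.
by move=> x; rewrite -{1}(pic_reprK x) pic_addE -[RHS]pic_reprK; apply/pic_ofP/tens_iso1.
Qed.

Fact pic_addN : left_inverse pic_zero pic_opp pic_add.
Proof.
move=> x; rewrite -{2}(pic_reprK x) pic_addE; apply/pic_ofP.
by apply: (lmod_iso_trans (tens_isoC _ _)); case: cid.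
Qed.

HB.instance Definition _ :=
  GRing.isZmodule.Build pic pic_addA pic_addC pic_add0 pic_addN.

End Pic.

Definition restriction (R S : comNzRingType) (phi : {rmorphism R -> S})
  (P : lmodType S) : Type := P.

Section Restriction.
Variables (R S : comNzRingType) (phi : {rmorphism R -> S}) (P : lmodType S).

Local Notation restrict := (restriction phi P).

HB.instance Definition _ := GRing.Zmodule.copy restrict P.

Definition restrict_scale (a : R) (x : restrict) : restrict :=
  (phi a *: (x : P) : P).

Fact restrict_scaleA a b (x : restrict) :
  restrict_scale a (restrict_scale b x) = restrict_scale (a * b) x.
Proof. by rewrite /restrict_scale scalerA rmorphM. Qed.

Fact restrict_scale1 : left_id 1 restrict_scale.
Proof. by move=> x; rewrite /restrict_scale rmorph1; exact: scale1r. Qed.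

Fact restrict_scaleDr : right_distributive restrict_scale +%R.
Proof. by move=> a x y; exact: scalerDr. Qed.

Fact restrict_scaleDl (x : restrict) :
  {morph restrict_scale^~ x : a b / a + b}.
Proof. by move=> a b; rewrite /restrict_scale rmorphD; exact: scalerDl. Qed.

HB.instance Definition _ := GRing.Zmodule_isLmodule.Build R restrict
  restrict_scaleA restrict_scale1 restrict_scaleDr restrict_scaleDl.

End Restriction.

Section BaseChange.
Variables (R S : comNzRingType) (phi : {rmorphism R -> S}).

Section Module.
Variable M : lmodType R.

Definition base_change : Type := tens M (restriction phi S^o).

HB.instance Definition _ :=
  GRing.Zmodule.copy base_change (tens M (restriction phi S^o)).

Definition bpure (m : M) (s : S) : base_change :=
  pure m (s : restriction phi S^o).

Fact bc_scale_bilin (s : S) :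
  bilin (fun (m : M) (t : restriction phi S^o) =>
    pure m (s * (t : S) : restriction phi S^o)).
Proof.
split=> [m m' t|m t t'|a m t|a m t].
- exact: pureDl.
- by rewrite -pureDr; congr pure; exact: mulrDr.
- exact: pureZl.
- by rewrite -pureZr; congr pure; exact: mulrCA.
Qed.

Definition bc_scale (s : S) (x : base_change) : base_change :=
  tens_lift (bc_scale_bilin s) x.

Lemma bc_scaleE s m t : bc_scale s (bpure m t) = bpure m (s * t).
Proof. exact: tens_liftE. Qed.

Fact bc_scale_add s : {morph bc_scale s : x y / x + y}.
Proof. exact: linearD. Qed.

Lemma bc_tens_ind (P : base_change -> Prop) :
  (forall m s, P (bpure m s)) -> (forall x y, P x -> P y -> P (x + y)) ->
  forall x, P x.
Proof. exact: (@tens_ind R M (restriction phi S^o) P). Qed.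

Fact bc_scaleA a b (x : base_change) :
  bc_scale a (bc_scale b x) = bc_scale (a * b) x.
Proof.
elim/bc_tens_ind: x => [m s|x y IHx IHy]; last first.
  by rewrite !bc_scale_add IHx IHy.
by rewrite !bc_scaleE mulrA.
Qed.

Fact bc_scale1 : left_id 1 bc_scale.
Proof.
elim/bc_tens_ind=> [m s|x y IHx IHy]; first by rewrite bc_scaleE mul1r.
by rewrite bc_scale_add IHx IHy.
Qed.

Fact bc_scaleDr : right_distributive bc_scale +%R.
Proof. by move=> a x y; rewrite bc_scale_add. Qed.

Lemma bpureDr m s t : bpure m (s + t) = bpure m s + bpure m t.
Proof. exact: pureDr. Qed.

Lemma bpureDl m n s : bpure (m + n) s = bpure m s + bpure n s.
Proof. exact: pureDl. Qed.

Fact bc_scaleDl (x : base_change) : {morph bc_scale^~ x : a b / a + b}.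
Proof.
move=> a b; elim/bc_tens_ind: x => [m s|x y IHx IHy].
  by rewrite !bc_scaleE mulrDl bpureDr.
by rewrite !bc_scale_add IHx IHy addrACA.
Qed.

HB.instance Definition _ := GRing.Zmodule_isLmodule.Build S base_change
  bc_scaleA bc_scale1 bc_scaleDr bc_scaleDl.

Lemma bc_scalepE s m t : s *: bpure m t = bpure m (s * t).
Proof. exact: bc_scaleE. Qed.

Lemma bpureZ s m : bpure m s = s *: bpure m 1.
Proof. by rewrite bc_scalepE mulr1. Qed.

Lemma bpureZl a m s : bpure (a *: m) s = phi a *: bpure m s.
Proof.
rewrite bc_scalepE /bpure pureZl -pureZr.
by congr pure.
Qed.

Lemma bc_ind (P : base_change -> Prop) :
  (forall m, P (bpure m 1)) -> (forall x y, P x -> P y -> P (x + y)) ->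
  (forall s x, P x -> P (s *: x)) -> forall x, P x.
Proof.
by move=> P1 PD PZ; elim/bc_tens_ind=> // m s; rewrite bpureZ; exact/PZ/P1.
Qed.

End Module.

Section Lift.
Variables (M : lmodType R) (P : lmodType S) (f : {linear M -> restriction phi P}).

Fact bc_lift_bilin :
  bilin (fun (m : M) (s : restriction phi S^o) =>
    ((s : S) *: (f m : P) : P) : restriction phi P).
Proof.
split=> [m m' s|m s s'|a m s|a m s].
- by rewrite linearD; exact: (@scalerDr S P s (f m) (f m')).
- exact: (@scalerDl S P (f m) s s').
- rewrite linearZ; have := @scalerA S P s (phi a) (f m).
  by rewrite mulrC -scalerA => ->.
- have := @scalerA S P (phi a) s (f m).
  by move=> <-.
Qed.

Definition bc_lift_fun (x : base_change M) : P := tens_lift bc_lift_bilin x.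

Lemma bc_lift_funE m s : bc_lift_fun (bpure m s) = s *: (f m : P).
Proof. exact: (tens_liftE bc_lift_bilin m s). Qed.

Fact bc_lift_add : {morph bc_lift_fun : x y / x + y}.
Proof. move=> x y; exact: (linearD (tens_lift bc_lift_bilin)). Qed.

Fact bc_lift_linear : linear bc_lift_fun.
Proof.
move=> a x y; rewrite bc_lift_add; congr (_ + _).
elim/bc_tens_ind: x => [m s|x {}y IHx IHy].
  by rewrite bc_scalepE !bc_lift_funE scalerA.
by rewrite scalerDr !bc_lift_add IHx IHy scalerDr.
Qed.

Definition bc_lift : {linear base_change M -> P} := linear_of bc_lift_linear.

Lemma bc_liftE m : bc_lift (bpure m 1) = f m.
Proof. by rewrite [LHS]bc_lift_funE scale1r. Qed.

End Lift.

Lemma bc_iso1 : lmod_iso (base_change R^o) S^o.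
Proof.
have l : linear (fun a : R^o => phi a : restriction phi S^o).
  by move=> a b c; rewrite /= rmorphD rmorphM.
exists (bc_lift (linear_of l)); exists (fun s => bpure (1 : R^o) s) => [|s].
  elim/bc_ind=> [m|x y IHx IHy|s x IHx].
  - rewrite bc_liftE bpureZ -[X in _ = bpure X 1](mulr1 m).
    by rewrite -[m * 1]/(m *: (1 : R^o)) bpureZl.
  - by rewrite linearD bpureDr IHx IHy.
  - by rewrite linearZ -[in RHS]IHx bc_scalepE.
by rewrite bpureZ linearZ bc_liftE; apply: etrans (mulr1 s); congr (_ * _); exact: rmorph1.
Qed.

Fact bc_map_linear (M N : lmodType R) (f : {linear M -> N}) :
  linear (fun m => bpure (f m) 1 : restriction phi (base_change N)).
Proof. by move=> a x y; rewrite linearP bpureDl bpureZl. Qed.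

Lemma bc_iso (M N : lmodType R) :
  lmod_iso M N -> lmod_iso (base_change M) (base_change N).
Proof.
move=> MN; have [f [g fK gK]] := MN.
have lg : linear g.
  by move=> a x y; apply: (can_inj fK); rewrite linearP !gK.
exists (bc_lift (linear_of (bc_map_linear f))).
exists (bc_lift (linear_of (bc_map_linear (linear_of lg)))).
  elim/bc_ind=> [m|x y IHx IHy|s x IHx].
  - by rewrite !bc_liftE /= /linear_of_fun fK.
  - by rewrite !linearD IHx IHy.
  - by rewrite !linearZ IHx.
elim/bc_ind=> [m|x y IHx IHy|s x IHx].
- by rewrite !bc_liftE /= /linear_of_fun gK.
- by rewrite !linearD IHx IHy.
- by rewrite !linearZ IHx.
Qed.

Section Monoidal.
Variables M N : lmodType R.

Fact bc_tens_bilin :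
  bilin (fun (m : M) (n : N) => pure (bpure m 1) (bpure n 1)
           : restriction phi (tens (base_change M) (base_change N))).
Proof.
split=> [m m' n|m n n'|a m n|a m n].
- by rewrite bpureDl pureDl.
- by rewrite bpureDl pureDr.
- by rewrite bpureZl pureZl.
- by rewrite bpureZl pureZr.
Qed.

Fact bc_inner_linear (m : M) :
  linear (fun n : N => bpure (pure m n) 1
            : restriction phi (base_change (tens M N))).
Proof. by move=> a n n'; rewrite pureDr pureZr bpureDl bpureZl. Qed.

Definition bc_inner (m : M) : {linear base_change N -> base_change (tens M N)} :=
  bc_lift (linear_of (bc_inner_linear m)).

Lemma bc_innerE m n : bc_inner m (bpure n 1) = bpure (pure m n) 1.
Proof. exact: bc_liftE. Qed.

Fact bc_outer_linear (y : base_change N) :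
  linear (fun m : M => bc_inner m y
            : restriction phi (base_change (tens M N))).
Proof.
move=> a m m'; rewrite -[a *: _ in RHS]/(phi a *: bc_inner m y).
elim/bc_ind: y => [n|x y IHx IHy|s x IHx].
- by rewrite !bc_innerE pureDl pureZl bpureDl bpureZl.
- by rewrite !linearD IHx IHy ?scalerDr addrACA.
- by rewrite !linearZ IHx /= ?scalerDr !scalerA mulrC.
Qed.

Definition bc_outer (y : base_change N) :
    {linear base_change M -> base_change (tens M N)} :=
  bc_lift (linear_of (bc_outer_linear y)).

Lemma bc_outer1E m y : bc_outer y (bpure m 1) = bc_inner m y.
Proof. exact: (bc_liftE (linear_of (bc_outer_linear y))). Qed.

Lemma bc_outerE m n : bc_outer (bpure n 1) (bpure m 1) = bpure (pure m n) 1.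
Proof. by rewrite bc_outer1E bc_innerE. Qed.

Fact bc_outer_bilin : bilin (fun x y => bc_outer y x).
Proof.
split=> [x x' y|x y y'|a x y|a x y]; rewrite ?linearD ?linearZ //.
- elim/bc_ind: x => [m|x x' IHx IHx'|s x IHx].
  + by rewrite !bc_outer1E linearD.
  + by rewrite !linearD IHx IHx' addrACA.
  + by rewrite !linearZ IHx /= ?scalerDr.
- elim/bc_ind: x => [m|x x' IHx IHx'|s x IHx].
  + by rewrite !bc_outer1E linearZ.
  + by rewrite !linearD IHx IHx'.
  + by rewrite !linearZ IHx /= !scalerA mulrC.
Qed.

Lemma bc_iso_tens :
  lmod_iso (base_change (tens M N)) (tens (base_change M) (base_change N)).
Proof.
pose F := bc_lift (tens_lift bc_tens_bilin).
pose G := tens_lift bc_outer_bilin.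
have FE m n : F (bpure (pure m n) 1) = pure (bpure m 1) (bpure n 1).
  by rewrite [LHS]bc_liftE tens_liftE.
have GE m n : G (pure (bpure m 1) (bpure n 1)) = bpure (pure m n) 1.
  by rewrite [LHS]tens_liftE bc_outerE.
exists F; exists G.
  elim/bc_ind=> [t|x y IHx IHy|s x IHx].
  - elim/tens_ind: t => [m n|x y IHx IHy]; first by rewrite FE GE.
    by rewrite bpureDl !linearD IHx IHy.
  - by rewrite !linearD IHx IHy.
  - by rewrite !linearZ IHx.
elim/tens_ind=> [x y|x y IHx IHy]; last by rewrite !linearD IHx IHy.
elim/bc_ind: x => [m|x x' IHx IHx'|s x IHx].
- elim/bc_ind: y => [n|y y' IHy IHy'|s y IHy]; first by rewrite GE FE.
    by rewrite pureDr !linearD IHy IHy'.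
  by rewrite pureZr !linearZ IHy.
- by rewrite pureDl !linearD IHx IHx'.
- by rewrite pureZl !linearZ IHx.
Qed.

End Monoidal.

Lemma invertible_bc (M : lmodType R) : invertible M -> invertible (base_change M).
Proof.
case=> N h; exists (base_change N).
apply: (lmod_iso_trans (lmod_iso_sym (bc_iso_tens M N))).
exact: (lmod_iso_trans (bc_iso h) bc_iso1).
Qed.

Definition pic_pullback (x : pic R) : pic S :=
  pic_of (invertible_bc (pic_repr_inv x)).

Lemma pic_pullbackE (M : lmodType R) (iM : invertible M) :
  pic_pullback (pic_of iM) = pic_of (invertible_bc iM).
Proof.
apply/pic_ofP/bc_iso/(pic_ofP (pic_repr_inv _) iM); exact: pic_reprK.
Qed.

Fact pic_pullback_nmod : nmod_morphism pic_pullback.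
Proof.
split=> [|x y]; first by rewrite [LHS]pic_pullbackE; apply/pic_ofP/bc_iso1.
rewrite -(pic_reprK x) -(pic_reprK y) [_ + _ in LHS]pic_addE !pic_pullbackE.
rewrite [RHS]pic_addE; exact/pic_ofP/bc_iso_tens.
Qed.

HB.instance Definition _ :=
  GRing.isNmodMorphism.Build (pic R) (pic S) pic_pullback pic_pullback_nmod.

Definition pic_ker_pred : {pred pic R} := [pred x | pic_pullback x == 0].

Fact pic_ker_closed : zmod_closed pic_ker_pred.
Proof.
split=> [|x y]; first by rewrite inE raddf0.
by rewrite !inE raddfB => x0 y0; rewrite /= x0 y0 subr0.
Qed.

HB.instance Definition _ :=
  GRing.isZmodClosed.Build (pic R) pic_ker_pred pic_ker_closed.

Record pic_ker := PicKer { pic_ker_val :> pic R; _ : pic_ker_val \in pic_ker_pred }.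

HB.instance Definition _ := [isSub for pic_ker_val].
HB.instance Definition _ := [Choice of pic_ker by <:].
HB.instance Definition _ := [SubChoice_isSubZmodule of pic_ker by <:].

End BaseChange.

(* An abelian group killed by the prime p, as a vector space over 'F_p.        *)
Definition Fp_space (p : nat) (V : zmodType) (p_prime : prime p)
  (Vp : forall x : V, x *+ p = 0) : Type := V.

Section FpSpace.
Variables (p : nat) (V : zmodType) (p_prime : prime p).
Hypothesis Vp : forall x : V, x *+ p = 0.

Local Notation W := (Fp_space p_prime Vp).

HB.instance Definition _ := GRing.Zmodule.copy W V.

Definition Fp_scale (c : 'F_p) (x : W) : W := (x : V) *+ (c : nat).

Lemma Fp_mulrn_mod n (x : V) : x *+ (n %% p) = x *+ n.
Proof.
by rewrite [in RHS](divn_eq n p) mulrnDr mulnC mulrnA Vp mul0rn add0r.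
Qed.

Fact Fp_scaleA a b (x : W) : Fp_scale a (Fp_scale b x) = Fp_scale (a * b) x.
Proof.
rewrite /Fp_scale -mulrnA /= -[RHS]/((x : V) *+ _) mulnC.
by rewrite [X in (_ * _ %% X)%N]Fp_cast // Fp_mulrn_mod.
Qed.

Fact Fp_scale1 : left_id 1 Fp_scale.
Proof. by move=> x; rewrite /Fp_scale /= modn_small. Qed.

Fact Fp_scaleDr : right_distributive Fp_scale +%R.
Proof. by move=> a x y; rewrite /Fp_scale; exact: mulrnDl. Qed.

Fact Fp_scaleDl (x : W) : {morph Fp_scale^~ x : a b / a + b}.
Proof.
move=> a b; rewrite /Fp_scale /= [X in (_ %% X)%N]Fp_cast // Fp_mulrn_mod.
exact: mulrnDr.
Qed.

HB.instance Definition _ := GRing.Zmodule_isLmodule.Build 'F_p W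
  Fp_scaleA Fp_scale1 Fp_scaleDr Fp_scaleDl.

End FpSpace.

Section Dimension.
Variables (F : fieldType) (V : lmodType F).

Definition lin_indep (n : nat) (e : 'I_n -> V) : Prop :=
  forall c : 'I_n -> F, \sum_(i < n) c i *: e i = 0 -> forall i, c i = 0.

Definition spanning (n : nat) (e : 'I_n -> V) : Prop :=
  forall x : V, exists c : 'I_n -> F, x = \sum_(i < n) c i *: e i.

Definition has_dim (n : nat) : Prop :=
  exists e : 'I_n -> V, lin_indep e /\ spanning e.

(* n <= dim V; this also makes sense when V is infinite-dimensional. *)
Definition dim_ge (n : nat) : Prop := exists e : 'I_n -> V, lin_indep e.

End Dimension.

Section QuotientRule.
Variables (F : fieldType) (a b c d a' b' c' d' : F).
Hypotheses (b0 : b != 0) (d0 : d != 0).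

Lemma quotient_ruleM :
  ((a' * c + a * c') * (b * d) - a * c * (b' * d + b * d')) / (b * d) ^+ 2 =
  (a' * b - a * b') / b ^+ 2 * (c / d) + a / b * ((c' * d - c * d') / d ^+ 2).
Proof. by field; rewrite b0 d0. Qed.

Lemma quotient_ruleD :
  ((a' * d + a * d' + (c' * b + c * b')) * (b * d)
     - (a * d + c * b) * (b' * d + b * d')) / (b * d) ^+ 2 =
  (a' * b - a * b') / b ^+ 2 + (c' * d - c * d') / d ^+ 2.
Proof. by field; rewrite b0 d0. Qed.

Lemma logder_sum : (a * d + b * c) / (b * d) = a / b + c / d.
Proof. by field; rewrite b0 d0. Qed.

Lemma inv_rule : b * (- a / b ^+ 2) = - (a / b).
Proof. by field. Qed.

Lemma logder_inv : - a / b ^+ 2 / b^-1 = - (a / b).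
Proof. by rewrite invrK; field. Qed.

End QuotientRule.

Section Derivations.
Variables (k : fieldType) (A : idomainAlgType k).
Implicit Types (a b : A) (f g : {fraction A}).

Record derivation := Derivation {
  der_fun :> {linear A -> A};
  der_leibniz : forall a b, der_fun (a * b) = der_fun a * b + a * der_fun b }.

Definition derivations_vanishing_on (B : subalgClosed A) : set derivation :=
  [set D | forall b, b \in B -> D b = 0].

(* The extension of D to K(A), by the quotient rule applied to a chosen        *)
(* representative n / d; der_frac_div shows that the choice is immaterial.     *)
Definition der_frac (D : derivation) (f : {fraction A}) : {fraction A} :=
  let n := \n_(repr f) in let d := \d_(repr f) in
  tofrac (D n * d - n * D d) / tofrac (d ^+ 2).

Lemma frac_repr f :
  \d_(repr f) != 0 /\ f = tofrac \n_(repr f) / tofrac \d_(repr f).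
Proof.
set x := repr f; have d0 : \d_x != 0 by case: (x).
have -> : f = \pi_({fraction A}) x by rewrite /x reprK.
split=> //; have d1 : tofrac \d_x != 0 by rewrite tofrac_eq0.
apply: (mulIf d1); rewrite divfK //; move: d0; rewrite {d1}; clearbody x => d0.
unlock tofrac; rewrite -[LHS](FracField.pi_mul x (Ratio \d_x 1)).
apply/eqmodP; rewrite /= FracField.equivfE /FracField.mulf.
by rewrite !numden_Ratio ?mulr1 ?oner_neq0 //= mulrC.
Qed.

Section OneDerivation.
Variable D : derivation.

Lemma der_frac_div a b : b != 0 ->
  der_frac D (tofrac a / tofrac b) =
  tofrac (D a * b - a * D b) / tofrac (b ^+ 2).
Proof.
move=> b0; rewrite /der_frac; set f := tofrac a / tofrac b.
have [] := frac_repr f; set n := \n_(repr f); set d := \d_(repr f) => d0.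
rewrite /f => /eqP; rewrite eqr_div ?tofrac_eq0 // -!tofracM tofrac_eq => /eqP E.
have DE : D a * d + a * D d = D n * b + n * D b by rewrite -!der_leibniz E.
apply/eqP; rewrite eqr_div ?tofrac_eq0 ?expf_neq0 // -!tofracM tofrac_eq.
rewrite -subr_eq0.
have -> : (D n * d - n * D d) * b ^+ 2 - (D a * b - a * D b) * d ^+ 2 =
  (d * D b + b * D d) * (a * d - n * b)
  - d * b * (D a * d + a * D d - (D n * b + n * D b)) by ring.
by rewrite DE E !subrr !mulr0 subrr.
Qed.

Lemma der1 : D 1 = 0.
Proof.
by apply: (addIr (D 1)); rewrite add0r -[in RHS](mulr1 1) der_leibniz mulr1 mul1r.
Qed.

Lemma der_frac_tofrac a : der_frac D (tofrac a) = tofrac (D a).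
Proof.
rewrite -[tofrac a]divr1 -tofrac1 der_frac_div ?oner_neq0 //.
by rewrite der1 mulr0 subr0 mulr1 expr1n tofrac1 divr1.
Qed.

Lemma der_fracM f g :
  der_frac D (f * g) = der_frac D f * g + f * der_frac D g.
Proof.
have [] := frac_repr f; set a := \n_(repr f); set b := \d_(repr f) => b0 ->.
have [] := frac_repr g; set c := \n_(repr g); set d := \d_(repr g) => d0 ->.
rewrite mulf_div -!tofracM !der_frac_div ?mulf_neq0 // !der_leibniz.
rewrite !(tofracM, tofracB, tofracD, tofracXn).
by apply: quotient_ruleM; rewrite tofrac_eq0.
Qed.

Lemma der_fracD f g : der_frac D (f + g) = der_frac D f + der_frac D g.
Proof.
have [] := frac_repr f; set a := \n_(repr f); set b := \d_(repr f) => b0 ->.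
have [] := frac_repr g; set c := \n_(repr g); set d := \d_(repr g) => d0 ->.
rewrite addf_div ?tofrac_eq0 // -!tofracM -tofracD !der_frac_div ?mulf_neq0 //.
rewrite !linearD /= !der_leibniz.
rewrite !(tofracM, tofracB, tofracD, tofracXn).
by apply: quotient_ruleD; rewrite tofrac_eq0.
Qed.

Lemma der_frac1 : der_frac D 1 = 0.
Proof. by rewrite -tofrac1 der_frac_tofrac der1 tofrac0. Qed.

Lemma der_fracX f n : der_frac D (f ^+ n.+1) = (f ^+ n * der_frac D f) *+ n.+1.
Proof.
elim: n => [|n IHn]; first by rewrite expr1 expr0 mul1r.
rewrite exprS der_fracM {}IHn mulrnAr mulrA -exprS [in RHS]mulrS mulrC.
by [].
Qed.

End OneDerivation.

Section Solutions.
Variable DD : set derivation.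

Definition algebraic_solution f : Prop :=
  f != 0 /\ forall D, DD D -> exists a, der_frac D f / f = tofrac a.

Definition first_integral f : Prop :=
  f != 0 /\ forall D, DD D -> der_frac D f = 0.

Lemma algebraic_solution1 : algebraic_solution 1.
Proof.
split=> [|D _]; first exact: oner_neq0.
by exists 0; rewrite der_frac1 mul0r tofrac0.
Qed.

Lemma algebraic_solutionM f g :
  algebraic_solution f -> algebraic_solution g -> algebraic_solution (f * g).
Proof.
move=> [f0 fP] [g0 gP]; split=> [|D dD]; first exact: mulf_neq0.
have [a fa] := fP D dD; have [b gb] := gP D dD; exists (a + b).
by rewrite der_fracM tofracD -fa -gb; apply: logder_sum.
Qed.

Lemma der_fracV D f : f != 0 -> der_frac D f^-1 = - der_frac D f / f ^+ 2.
Proof.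
move=> f0; have := der_frac1 D; rewrite -[X in der_frac D X = 0](mulfV f0).
rewrite der_fracM => /eqP; rewrite addr_eq0 => /eqP h.
apply: (mulfI f0); rewrite -[LHS]opprK -h; apply/esym; exact: inv_rule.
Qed.

Lemma algebraic_solutionV f : algebraic_solution f -> algebraic_solution f^-1.
Proof.
move=> [f0 fP]; split=> [|D dD]; first by rewrite invr_eq0.
have [a fa] := fP D dD; exists (- a).
by rewrite der_fracV // tofracN -fa; apply: logder_inv.
Qed.

Lemma first_integral1 : first_integral 1.
Proof. by split=> [|D _]; [exact: oner_neq0 | exact: der_frac1]. Qed.

Lemma first_integralM f g :
  first_integral f -> first_integral g -> first_integral (f * g).
Proof.
move=> [f0 fP] [g0 gP]; split=> [|D dD]; first exact: mulf_neq0.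
by rewrite der_fracM fP // gP // mul0r mulr0 addr0.
Qed.

Lemma first_integralV f : first_integral f -> first_integral f^-1.
Proof.
move=> [f0 fP]; split=> [|D dD]; first by rewrite invr_eq0.
by rewrite der_fracV // fP // oppr0 mul0r.
Qed.

Lemma first_integralX p f : p \in [pchar k] -> f != 0 -> first_integral (f ^+ p).
Proof.
move=> kp f0; split=> [|D _]; first exact: expf_neq0.
have p0 : p%:R = 0 :> {fraction A}.
  rewrite -(rmorph_nat (@tofrac A)) -[p%:R : A]scaler_nat.
  by rewrite (pcharf0 kp) scale0r rmorph0.
rewrite -(prednK (prime_gt0 (pcharf_prime kp))) der_fracX.
by rewrite prednK ?prime_gt0 ?(pcharf_prime kp) // -mulr_natr p0 mulr0.
Qed.

Record solution := Solution {
  solution_val :> {fraction A};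
  solutionP : `[< algebraic_solution solution_val >] }.

HB.instance Definition _ := [isSub for solution_val].
HB.instance Definition _ := [Choice of solution by <:].

Definition sol_one : solution := Solution (asboolT algebraic_solution1).
Definition sol_mul (f g : solution) : solution :=
  Solution (asboolT (algebraic_solutionM (asboolW (solutionP f))
                                         (asboolW (solutionP g)))).
Definition sol_inv (f : solution) : solution :=
  Solution (asboolT (algebraic_solutionV (asboolW (solutionP f)))).

Lemma sol_neq0 (f : solution) : solution_val f != 0.
Proof. by case: (asboolW (solutionP f)). Qed.

Definition sol_rel (f g : solution) : bool :=
  `[< first_integral (solution_val f / solution_val g) >].

Fact sol_rel_equiv : equiv_class_of sol_rel.
Proof.
split=> [f|f g|f g h].
- apply/asboolP; rewrite divff ?sol_neq0 //; exact: first_integral1.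
- by apply/asboolP/asboolP => /first_integralV; rewrite invf_div.
- move=> /asboolP gf /asboolP fh; apply/asboolP.
  have := first_integralM gf fh; rewrite mulrA divfK ?sol_neq0 //.
Qed.

Canonical sol_equiv := EquivRelPack sol_rel_equiv.

(* Algebraic solutions modulo first integrals, written additively. *)
Definition Pi_group := {eq_quot sol_rel}.

HB.instance Definition _ : EqQuotient _ sol_rel Pi_group :=
  EqQuotient.on Pi_group.
HB.instance Definition _ := Choice.on Pi_group.

Definition Pi_class (f : solution) : Pi_group := \pi_Pi_group f.

Lemma Pi_classP (f g : solution) :
  Pi_class f = Pi_class g <-> first_integral (solution_val f / solution_val g).
Proof.
split=> [/eqP|fg]; first by rewrite /Pi_class eqmodE => /asboolP.
by apply/eqP; rewrite /Pi_class eqmodE; apply/asboolP.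
Qed.

Lemma Pi_reprK x : Pi_class (repr x) = x.
Proof. exact: reprK. Qed.

Lemma Pi_class_eq (f g : solution) :
  solution_val f = solution_val g -> Pi_class f = Pi_class g.
Proof. by move=> fg; congr Pi_class; apply: val_inj. Qed.

Definition Pi_add (x y : Pi_group) : Pi_group :=
  Pi_class (sol_mul (repr x) (repr y)).
Definition Pi_opp (x : Pi_group) : Pi_group := Pi_class (sol_inv (repr x)).

Lemma Pi_addE (f g : solution) :
  Pi_add (Pi_class f) (Pi_class g) = Pi_class (sol_mul f g).
Proof.
apply/Pi_classP => /=; rewrite -mulf_div.
by apply: first_integralM; apply/Pi_classP/Pi_reprK.
Qed.

Fact Pi_addA : associative Pi_add.
Proof.
move=> x y z; rewrite -(Pi_reprK x) -(Pi_reprK y) -(Pi_reprK z) !Pi_addE.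
by apply: Pi_class_eq; rewrite /= mulrA.
Qed.

Fact Pi_addC : commutative Pi_add.
Proof. by move=> x y; apply: Pi_class_eq; rewrite /= mulrC. Qed.

Fact Pi_add0 : left_id (Pi_class sol_one) Pi_add.
Proof.
by move=> x; rewrite -(Pi_reprK x) Pi_addE; apply: Pi_class_eq; rewrite /= mul1r.
Qed.

Fact Pi_addN : left_inverse (Pi_class sol_one) Pi_opp Pi_add.
Proof.
move=> x; rewrite -[X in Pi_add _ X]Pi_reprK Pi_addE.
by apply: Pi_class_eq; rewrite /= mulVf ?sol_neq0.
Qed.

HB.instance Definition _ :=
  GRing.isZmodule.Build Pi_group Pi_addA Pi_addC Pi_add0 Pi_addN.

Lemma Pi_pchar p : p \in [pchar k] -> forall x : Pi_group, x *+ p = 0.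
Proof.
move=> kp x; rewrite -(Pi_reprK x); set f := repr x.
have h n : exists2 g : solution,
    Pi_class f *+ n = Pi_class g & solution_val g = solution_val f ^+ n.
  elim: n => [|n [g gE gv]]; first by exists sol_one.
  exists (sol_mul f g); last by rewrite /= gv exprS.
  by rewrite mulrS gE [LHS]Pi_addE.
have [g -> gv] := h p; apply/Pi_classP; rewrite gv /= divr1.
exact/first_integralX/sol_neq0.
Qed.

End Solutions.

End Derivations.

Definition Pi_space (k : fieldType) (p : nat) (kp : p \in [pchar k])
    (A : idomainAlgType k) (DD : set (derivation A)) : lmodType 'F_p :=
  Fp_space (pcharf_prime kp) (Pi_pchar (DD := DD) kp).

(* Main.v *)
Require Import Defs.
From HB Require Import structures.
From mathcomp Require Import all_boot all_order all_algebra.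
From mathcomp Require Import ring zify.
From mathcomp Require Import boolp classical_sets cardinality.

(** Let F be the A-module of the k-derivations of A that vanish on B.

    The link between the kernel and F is as follows.  An invertible B-module M
    embeds in B as an ideal J.  If M becomes free over A, then JA = fA for some
    f.  Write f as a sum of products x c with x in J and c in A: for D in F,
    D f is the sum of the x (D c), hence lies in JA = fA, so that f is an
    algebraic solution of F (generates_pullback_der).  Tensor products of
    modules correspond to products of such f (generates_pullbackD).  Since B
    is normal and contains the p-th powers, A meets the fraction field of B in
    B; therefore f in B forces J = fB and M is free (generates_pullback_eq0).
    As f ^+ p is in B, the kernel is killed by p.

    The element f is defined up to a unit of A only, so it is a subgroup of the
    group of algebraic solutions that maps onto the kernel.  An element of A
    that all of F kills lies in B: a purely inseparable extension has enough
    derivations (ex_derivation_neq0, ex_vanishing_derivation).  So a monomial in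
    the f_i that is a first integral gives a relation between the classes of
    the M_i, and independent classes yield independent algebraic solutions.
    This is the inequality of dimensions.

    For the finiteness it is enough to bound the rank of any independent family
    of algebraic solutions (algebraic_solutions_rank_bounded).  The logarithmic
    derivative a = D f / f satisfies D^p f = (D^(p-1) a + a^p) f
    (hochschild_formula).  Now D^p is again in F, and F is generated over the
    noetherian ring A by finitely many D_j; hence the a_j = D_j f / f satisfy
      a_j^p = sum_l c_jl a_l - D_j^(p-1) a_j
    with c_jl independent of f (log_der_equation).  Filter A by the degree in
    its generators.  The right hand side raises degrees by a constant at most,
    while extracting a p-th root divides them by p up to a constant
    (deg_le_pth_root), so the degrees of all a_j are bounded once for all
    (log_der_degree): the a_j range over a finite-dimensional space over k.
    Finally the equation is semilinear: the coefficients of a shortest k-linear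
    relation between vectors (a_j) are fixed by the Frobenius, so families that
    are independent over the prime field are independent over k
    (log_der_scalar_indep).

    If A is a UFD, invertible A-modules are free (ufd_invertible_free), Pic(A)
    vanishes and the kernel is the whole of Pic(B). *)

Set Implicit Arguments.
Unset Strict Implicit.
Unset Printing Implicit Defensive.

Import GRing.Theory.

Local Open Scope classical_set_scope.
Local Open Scope ring_scope.

(** * Characteristic p *)

Lemma pchar_alg (k : fieldType) p (kp : p \in [pchar k]) (A : idomainAlgType k) :
  p \in [pchar A].
Proof. by rewrite pchar_lalg. Qed.

Lemma poly_pchar (k : fieldType) p (kp : p \in [pchar k])
    (A : idomainAlgType k) : p \in [pchar {poly A}].
Proof. exact: (rmorph_pchar (@polyC A) (pchar_alg kp A)). Qed.

Lemma sum_pth p (I : Type) (R : comNzRingType) (s : seq I) (F : I -> R) :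
  p \in [pchar R] -> (\sum_(i <- s) F i) ^+ p = \sum_(i <- s) F i ^+ p.
Proof.
move=> Rp; rewrite -(pFrobenius_autE Rp) rmorph_sum /=.
by apply: eq_bigr => i _; rewrite pFrobenius_autE.
Qed.

Lemma pth_inj p (R : idomainType) : p \in [pchar R] ->
  injective (fun x : R => x ^+ p).
Proof.
move=> Rp x y /=; rewrite -!(pFrobenius_autE Rp) => /eqP.
rewrite -subr_eq0 -rmorphB /= pFrobenius_autE expf_eq0 subr_eq0.
by move=> /andP[_ /eqP].
Qed.

Lemma ex_pth_root (k : closedFieldType) p (x : k) : (0 < p)%N ->
  exists y, y ^+ p = x.
Proof.
move=> p_gt0.
have [//|y yE] := @solve_monicpoly k p (fun j => if j is 0%N then x else 0).
exists y; rewrite yE -(prednK p_gt0) big_ord_recl big1 => [|j _].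
  by rewrite /= expr0 mulr1 addr0.
by rewrite mul0r.
Qed.

(** Otherwise X^p - X would have p + 1 roots. *)
Lemma Frobenius_fixed (k : fieldType) p (kp : p \in [pchar k]) (x : k) :
  x ^+ p = x -> exists m : nat, x = m%:R.
Proof.
move=> xp; apply: contrapT => nx.
have p1 := prime_gt1 (pcharf_prime kp).
pose rs := x :: [seq i%:R | i <- iota 0 p].
pose P : {poly k} := 'X^p - 'X.
have P0 : P != 0.
  by rewrite -size_poly_gt0 size_polyDl ?size_polyXn // size_polyN size_polyX.
have [] := negP (_ : ~~ (size rs < size P)%N); last first.
  apply: max_poly_roots => //.
    rewrite /= /root /P !hornerE xp subrr eqxx /=.
    apply/allP => _ /mapP[i _ ->].
    rewrite /root /P !hornerE -(pFrobenius_autE kp) pFrobenius_aut_nat subrr.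
    exact: eqxx.
  rewrite cons_uniq; apply/andP; split.
    by apply/mapP => -[i _ xi]; apply: nx; exists i.
  rewrite map_inj_in_uniq ?iota_uniq // => i j.
  rewrite !mem_iota !add0n /= => ip jp /eqP.
  wlog ij : i j ip jp / (i <= j)%N.
    move=> h e; have [ij|/ltnW ji] := leqP i j; first exact: h.
    by apply/esym; apply: h => //; rewrite eq_sym.
  rewrite eq_sym -subr_eq0 -natrB // -(dvdn_pcharf kp) => /eqP.
  rewrite modn_small ?(leq_ltn_trans (leq_subr _ _)) // => /eqP.
  by rewrite subn_eq0 => ji; apply/eqP; rewrite eqn_leq ij.
rewrite size_polyDl ?size_polyXn ?size_polyN ?size_polyX //.
by rewrite /= size_map size_iota ltnn.
Qed.

Lemma sum_pchar_bin (R : nzRingType) p (F : nat -> R) : p \in [pchar R] ->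
  \sum_(i < p.+1) F i *+ 'C(p, i) = F 0%N + F p.
Proof.
move=> Rp; have p_gt0 : (0 < p)%N := prime_gt0 (pcharf_prime Rp).
rewrite big_ord_recl bin0; congr (_ + _).
rewrite -(big_mkord xpredT (fun i => F i.+1 *+ 'C(p, i.+1))) -{1}(prednK p_gt0).
rewrite big_nat_recr //= prednK // binn big_nat big1 ?add0r // => i /andP[_ ip].
rewrite -mulr_natr [_%:R](_ : _ = 0) ?mulr0 //; apply/eqP.
rewrite -(dvdn_pcharf Rp) prime_dvd_bin ?(pcharf_prime Rp) //=.
by rewrite -ltnS prednK in ip.
Qed.

(** * Subrings and subalgebras given by propositional predicates *)

(** A named copy of P that carries the proof of closure, from which the
    subalgClosed structure can be inferred. *)
Definition closed_pred (k : pzRingType) (A : lalgType k) (P : set A)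
  of GRing.subalg_closed [pred a | `[< P a >]] : {pred A} := [pred a | `[< P a
    >]].

HB.instance Definition _ (k : pzRingType) (A : lalgType k) (P : set A)
    (hP : GRing.subalg_closed [pred a | `[< P a >]]) :=
  GRing.isSubalgClosed.Build k A (closed_pred hP) hP.

Lemma generation_ind (k : fieldType) (A : idomainAlgType k) (s : seq A)
    (s_gen : forall S : subalgClosed A, {subset s <= S} -> forall a : A, a \in S)
    (P : set A) :
  P 1 -> (forall (l : k) u v, P u -> P v -> P (l *: u + v)) ->
  (forall u v, P u -> P v -> P (u * v)) -> (forall x, x \in s -> P x) ->
  forall a, P a.
Proof.
move=> P1 PL PM Ps a.
have hP : GRing.subalg_closed [pred a | `[< P a >]].
  split=> [|l u v|u v]; rewrite ?unfold_in; first exact/asboolP.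
    by move=> /asboolP Pu /asboolP Pv; apply/asboolP/PL.
  by move=> /asboolP Pu /asboolP Pv; apply/asboolP/PM.
by apply/asboolP/(s_gen (closed_pred hP)) => x /Ps Px; apply/asboolP.
Qed.

(** The analogue of closed_pred for subrings. *)
Definition subring_pred (R : nzRingType) (S : set R)
  of GRing.subring_closed [pred a | `[< S a >]] : {pred R} := [pred a | `[< S a
    >]].

HB.instance Definition _ (R : nzRingType) (S : set R)
    (hS : GRing.subring_closed [pred a | `[< S a >]]) :=
  GRing.isSubringClosed.Build R (subring_pred hS) hS.

Lemma subring_of_set (R : nzRingType) (S : set R) :
  S 1 -> (forall x y, S x -> S y -> S (x - y)) ->
  (forall x y, S x -> S y -> S (x * y)) ->
  exists S' : subringClosed R, forall x, x \in S' <-> S x.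
Proof.
move=> S1 SB SM.
have hS : GRing.subring_closed [pred a | `[< S a >]].
  split=> [|x y|x y]; rewrite ?unfold_in; first exact/asboolP.
    by move=> /asboolP Sx /asboolP Sy; apply/asboolP/SB.
  by move=> /asboolP Sx /asboolP Sy; apply/asboolP/SM.
by exists (subring_pred hS : subringClosed R) => x; split=> [/asboolP|Sx] //;
  apply/asboolP.
Qed.

(** * Invertible modules over a domain *)

Section InvertibleModules.
Variables (R : idomainType) (M : lmodType R).
Implicit Types (x y z : M) (phi : {linear M -> R^o}).

Definition torsion_free (V : lmodType R) : Prop :=
  forall (a : R) (v : V), a *: v = 0 -> a != 0 -> v = 0.

(** Let f be an isomorphism from M (x) N to R and t = sum m_i (x) n_i the
    preimage of 1; put e(m, n) = f(m (x) n).  As x (x) n = e(x, n) t, the map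
    sending (x (x) n) (x) z to e(z, n) x gives
      e(z, n) x = e(x, n) tau(z),  where tau(z) = sum_i e(z, n_i) m_i.
    This identity makes tau injective and M torsion-free.  Comparing both sides
    for x = z shows that tau fixes an element with a nonzero coordinate, and
    then that tau is the identity: this is the dual basis, and the identity
    itself says that M has rank one. *)
Lemma invertible_rank1_projective : invertible M ->
  [/\ torsion_free M,
      exists s : seq (M * {linear M -> R^o}),
        forall z, z = \sum_(q <- s) q.2 z *: q.1,
      forall phi y z, phi y *: z = phi z *: y
    & exists (phi : {linear M -> R^o}) y, phi y != 0].
Proof.
case=> N [f bf]; have f_inj := bij_inj bf; case: bf => g fK gK.
pose t := g 1; have ft : f t = 1 by rewrite /t gK.
pose e (m : M) (n : N) : R := f (pure m n).
have eDl m m' n : e (m + m') n = e m n + e m' n by rewrite /e pureDl linearD.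
have eDr m n n' : e m (n + n') = e m n + e m n' by rewrite /e pureDr linearD.
have eZl a m n : e (a *: m) n = a * e m n by rewrite /e pureZl linearZ.
have eZr a m n : e m (a *: n) = a * e m n by rewrite /e pureZr linearZ.
have e_lin n : linear (e^~ n : M -> R^o) by move=> a m m'; rewrite eDl eZl.
pose phi_ n : {linear M -> R^o} := linear_of (e_lin n).
have sum_t : \sum_(mn <- repr t) e mn.1 mn.2 = 1.
  by rewrite -ft [in RHS](tens_sum t) linear_sum.
pose tau z := \sum_(mn <- repr t) e z mn.2 *: mn.1.
have tauZ a z : tau (a *: z) = a *: tau z.
  by rewrite /tau scaler_sumr; apply: eq_bigr => q _; rewrite eZl scalerA.
have tau0 : tau 0 = 0 by have := tauZ 0 0; rewrite !scale0r.
have bg z : bilin (fun (m : M) (n : N) => e z n *: m).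
  split=> [m m' n|m n n'|a m n|a m n].
  - by rewrite scalerDr.
  - by rewrite eDr scalerDl.
  - by rewrite !scalerA mulrC.
  - by rewrite eZr scalerA.
have bG : bilin (fun w z => tens_lift (bg z) w).
  apply: lift_bilin => [z z' m n|a z m n]; first by rewrite eDl scalerDl.
  by rewrite eZl scalerA.
(* The map (x (x) n) (x) z |-> e(z, n) x takes equal values on the two sides of
   x (x) n = e(x, n) t tensored with z. *)
have twist x z n : e z n *: x = e x n *: tau z.
  have := congr1 (fun w => tens_lift bG (pure w z))
    (_ : pure x n = e x n *: t).
  rewrite !tens_liftE linearZ => -> //.
  by apply: f_inj; rewrite linearZ ft /e; apply/esym/mulr1.
have tau_inj z : tau z = 0 -> z = 0.
  move=> tz; have h x n : e x n *: z = 0.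
    by rewrite twist -tauZ twist tz scaler0 tau0.
  rewrite -[z]scale1r -sum_t scaler_suml big1 // => q _; exact: h.
have tf : torsion_free M.
  move=> a v av0 a0; apply: tau_inj; rewrite /tau big1 // => q _.
  suff -> : e v q.2 = 0 by rewrite scale0r.
  have := eZl a v q.2; rewrite av0 -(scale0r v) eZl mul0r => /esym/eqP.
  by rewrite mulf_eq0 (negPf a0) => /eqP.
have [y [n c0]] : exists y n, e y n != 0.
  apply: contrapT => h; have /eqP := oner_neq0 R; apply.
  rewrite -sum_t big1 // => q _; apply: contrapT => /eqP eq0; apply: h.
  by exists q.1, q.2.
have cE x : e y n *: x = e x n *: tau y by exact: twist.
have tauy : tau y = y.
  apply/eqP; rewrite -subr_eq0; apply/eqP; apply: (tf (e y n)) => //.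
  by rewrite scalerBr -cE subrr.
have rank1 x : e y n *: x = e x n *: y by rewrite cE tauy.
have tauE x : tau x = x.
  apply/eqP; rewrite -subr_eq0; apply/eqP; apply: (tf (e y n)) => //.
  by rewrite scalerBr -tauZ rank1 tauZ tauy subrr.
have sym u v : e u n *: v = e v n *: u.
  apply/eqP; rewrite -subr_eq0; apply/eqP; apply: (tf (e y n)) => //.
  have h a w : e y n *: (a *: w) = (a * e w n) *: y.
    by rewrite -[RHS]scalerA -rank1 !scalerA mulrC.
  by rewrite scalerBr !h mulrC subrr.
split=> //.
- exists [seq (q.1, phi_ q.2) | q <- repr t] => z.
  by rewrite big_map -[LHS]tauE; apply: eq_bigr => q _.
- move=> phi u v; apply/eqP; rewrite -subr_eq0; apply/eqP.
  have phiE w : e y n * phi w = e w n * phi y.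
    by have := congr1 phi (rank1 w); rewrite !linearZ.
  apply: (tf (e y n)) => //; rewrite scalerBr !scalerA !phiE.
  by rewrite ![_ * phi y]mulrC -!scalerA sym subrr.
- by exists (phi_ n), y.
Qed.

End InvertibleModules.

(** By rank one, phi(y) z = phi(z) y for all z. *)
Lemma invertible_functional_inj (R : idomainType) (M : lmodType R)
    (phi : {linear M -> R^o}) :
  invertible M -> (exists y, phi y != 0) -> injective phi.
Proof.
move=> /invertible_rank1_projective[tf _ rank1 _] [y y0].
move=> u v /eqP; rewrite -subr_eq0 -linearB => /eqP uv0.
apply/eqP; rewrite -subr_eq0; apply/eqP; apply: (tf (phi y)) => //.
by rewrite rank1 uv0 scale0r.
Qed.

Lemma bij_functional_free (R : idomainType) (M : lmodType R)
    (phi : {linear M -> R^o}) y :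
  invertible M -> phi y \is a GRing.unit -> lmod_iso M R^o.
Proof.
move=> iM uy; have inj_phi : injective phi.
  apply: invertible_functional_inj => //; exists y.
  by apply: contraTneq uy => ->; rewrite unitr0.
have phiK (a : R^o) : phi ((a / phi y) *: y) = a.
  by rewrite linearZ; exact: divrK.
by exists phi; exists (fun a : R^o => (a / phi y) *: y) => // z; apply: inj_phi.
Qed.

Section Factorial.
Variables (R : idomainType) (ufdR : ufd R).

(** Factor both sides of a b = q c and use uniqueness; if c is a unit, q c is
    itself irreducible and is taken as the single factor of the right side. *)
Lemma irreducible_prime (q a b : R) : irreducible_elt q ->
  (exists c, a * b = q * c) -> (exists c, a = q * c) \/ (exists c, b = q * c).
Proof.
move=> irr_q [c abE]; have [q0 qU qP] := irr_q.
have [-> | a0] := eqVneq a 0; first by left; exists 0; rewrite mulr0.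
have [-> | b0] := eqVneq b 0; first by right; exists 0; rewrite mulr0.
have c0 : c != 0.
  by apply: contra_neq (mulf_neq0 a0 b0) => cz; rewrite abE cz mulr0.
have [ua | nua] := boolP (a \is a GRing.unit).
  by right; exists (a^-1 * c); rewrite mulrCA -abE mulKr.
have [ub | nub] := boolP (b \is a GRing.unit).
  by left; exists (c / b); rewrite mulrA -abE mulrK.
have [exfact uniq_fact] := ufdR.
have [sa [irr_sa aE]] := exfact a a0 nua.
have [sb [irr_sb bE]] := exfact b b0 nub.
have irr_ab y : y \in sa ++ sb -> irreducible_elt y.
  by rewrite mem_cat => /orP[]; auto.
(* A factorization of q * c with a first factor h that q divides. *)
have [h [s [irr_s hE [v hq]]]] : exists h s,
    [/\ forall y, y \in h :: s -> irreducible_elt y,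
        \prod_(y <- h :: s) y = q * c & exists v, h = q * v].
  have [uc | nuc] := boolP (c \is a GRing.unit).
    exists (q * c), [::]; rewrite big_seq1; split=> //; last by exists c.
    move=> y; rewrite inE => /eqP ->; split.
    - exact: mulf_neq0.
    - by rewrite unitrM uc andbT.
    - move=> y1 y2 yE; have := qP (y1 / c) y2.
      rewrite mulrAC -yE mulrK // unitrM unitrV uc andbT; exact.
  have [s [irr_s cE]] := exfact c c0 nuc.
  exists q, s; rewrite big_cons -cE; split=> //; last by exists 1; rewrite mulr1.
  by move=> y; rewrite inE => /orP[/eqP -> //|]; exact: irr_s.
have prodE : \prod_(y <- h :: s) y = \prod_(y <- sa ++ sb) y.
  by rewrite hE -abE aE bE big_cat.
have [sz [t' perm_t' ass]] := uniq_fact _ _ irr_s irr_ab prodE.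
have [u _ t'0] := ass 0%N isT.
have : t'`_0 \in sa ++ sb.
  by rewrite -(perm_mem perm_t') mem_nth // (perm_size perm_t') -sz.
rewrite t'0 /= hq mem_cat => /orP[/(perm_to_rem) pr|/(perm_to_rem) pr].
  by left; rewrite aE (perm_big _ pr) big_cons /= mulrCA -!mulrA; eexists.
by right; rewrite bE (perm_big _ pr) big_cons /= mulrCA -!mulrA; eexists.
Qed.

(** It suffices to find a functional psi and an element m with psi(m) a unit.
    Starting from psi(m) nonzero, remove its prime factors one at a time.  Let
    q divide psi(m).  If q divides all values of psi, replace psi by psi / q.
    Otherwise q does not divide some psi(z); since chi(m) psi(z) =
    chi(z) psi(m) for every functional chi, q divides chi(m) for all chi, so
    that m = q m' by the dual basis, and m' replaces m. *)
Lemma ufd_invertible_free (M : lmodType R) : invertible M -> lmod_iso M R^o.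
Proof.
move=> iM; have [tf [b bE] rank1 [phi [y y0]]] := invertible_rank1_projective iM.
have main (s : seq R) : (forall q, q \in s -> irreducible_elt q) ->
    forall (psi : {linear M -> R^o}) m u, u \is a GRing.unit ->
      psi m = u * \prod_(q <- s) q -> lmod_iso M R^o.
  elim: s => [|q s IHs] irr_s psi m u uu.
    rewrite big_nil mulr1 => mE; apply: (@bij_functional_free _ _ psi m) => //.
    by rewrite mE.
  have irr_q : irreducible_elt q by apply: irr_s; rewrite inE eqxx.
  have {}IHs := IHs (fun x xs => irr_s x (@mem_behead _ (q :: s) x xs)).
  have q0 : q != 0 by case: irr_q.
  rewrite big_cons mulrCA => mE.
  have [qpsi | /existsNP[z nz]] := pselect (forall z, exists c, psi z = q * c).
    pose psi' z : R^o := projT1 (cid (qpsi z)).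
    have psi'E z : psi z = q * psi' z by rewrite /psi'; case: cid.
    have l : linear psi'.
      move=> a v w; apply: (mulfI q0); rewrite -psi'E linearP !psi'E mulrDr.
      by congr (_ + _); exact: mulrCA.
    apply: (IHs (linear_of l) m u uu); apply: (mulfI q0).
    by rewrite -mE psi'E.
  have qdvd (chi : {linear M -> R^o}) : exists c, chi m = q * c.
    have := congr1 chi (rank1 psi m z); rewrite !linearZ => E.
    have [] := @irreducible_prime q (chi m) (psi z) irr_q; last 2 first.
    - by [].
    - by move/nz.
    exists (u * (\prod_(q <- s) q) * chi z).
    by rewrite mulrA -mE mulrC; exact/esym.
  pose d chi := projT1 (cid (qdvd chi)).
  have dE (chi : {linear M -> R^o}) : chi m = q * d chi by rewrite /d; case: cid.
  pose m' := \sum_(x <- b) d x.2 *: x.1.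
  have mm' : m = q *: m'.
    rewrite [LHS]bE scaler_sumr; apply: eq_bigr => x _.
    by rewrite scalerA dE.
  apply: (IHs psi m' u uu); apply: (mulfI q0); rewrite -mE mm' linearZ.
  by [].
have [uy | nuy] := boolP ((phi y : R) \is a GRing.unit).
  exact: (@bij_functional_free _ _ phi y).
have [exfact _] := ufdR; have [s [irr_s yE]] := exfact _ y0 nuy.
by apply: (main s irr_s phi y 1 (unitr1 _)); rewrite mul1r.
Qed.

End Factorial.

(** * Noetherian rings and the F-finiteness of algebras of finite type *)

Section LinearSpan.
Variables (R : comNzRingType) (V : lmodType R).
Implicit Types (s : seq V) (N : set V).

Definition submodule N : Prop :=
  N 0 /\ forall a x y, N x -> N y -> N (a *: x + y).

(** The impredicative form of the submodule spanned by s: it makes closure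
    properties immediate, and coefficients are only extracted in lspan_coef. *)
Definition lspan s : set V :=
  [set v | forall N, submodule N -> (forall x, x \in s -> N x) -> N v].

Lemma lspan_submodule s : submodule (lspan s).
Proof.
split=> [N [N0 _] _|a x y xs ys N subN sN]; first exact: N0.
by case: (subN) => _; apply; [exact: xs | exact: ys].
Qed.

Lemma lspan_mem s x : x \in s -> lspan s x.
Proof. by move=> xs N _; apply. Qed.

Lemma submoduleD N x y : submodule N -> N x -> N y -> N (x + y).
Proof. by move=> [_ subN] Nx Ny; rewrite -[x]scale1r; apply: subN. Qed.

Lemma submoduleZ N a x : submodule N -> N x -> N (a *: x).
Proof. by move=> [N0 subN] Nx; rewrite -[_ *: _]addr0; apply: subN. Qed.

Lemma submoduleB N x y : submodule N -> N x -> N y -> N (x - y).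
Proof.
by move=> [_ subN] Nx Ny; rewrite addrC -scaleN1r; apply: subN.
Qed.

Lemma submodule_sum N (I : Type) (r : seq I) (P : pred I) (F : I -> V) :
  submodule N -> (forall i, P i -> N (F i)) -> N (\sum_(i <- r | P i) F i).
Proof.
move=> subN NF; elim/big_ind: _ => //; first by case: subN.
by move=> x y; apply: submoduleD.
Qed.

Lemma lspan_sub s t v : (forall x, x \in s -> lspan t x) -> lspan s v ->
  lspan t v.
Proof. by move=> st; apply; [exact: lspan_submodule|]. Qed.

Lemma lspan_mono s t v : {subset s <= t} -> lspan s v -> lspan t v.
Proof. by move=> st; apply: lspan_sub => x /st; apply: lspan_mem. Qed.

Lemma lspan_cons x s v : lspan (x :: s) v ->
  exists a w, lspan s w /\ v = a *: x + w.
Proof.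
move=> h; apply: (h [set v | exists a w, lspan s w /\ v = a *: x + w]) => [|y].
  split=> [|b y z [a [w [sw ->]]] [a' [w' [sw' ->]]]].
    exists 0, 0; split; last by rewrite scale0r addr0.
    by case: (lspan_submodule s).
  exists (b * a + a'), (b *: w + w'); split.
    by case: (lspan_submodule s) => _; apply.
  by rewrite scalerDr scalerDl scalerA addrACA.
rewrite inE => /orP[/eqP ->|ys].
  exists 1, 0; split; last by rewrite scale1r addr0.
  by case: (lspan_submodule s).
by exists 0, y; split; [exact: lspan_mem | rewrite scale0r add0r].
Qed.

Lemma lspan_coef s v : lspan s v ->
  exists c : nat -> R, v = \sum_(i < size s) c i *: s`_i.
Proof.
elim: s v => [|x s IHs] v.
  move=> h; exists (fun=> 0); rewrite big_ord0.
  apply: (h [set w | w = 0]) => //; split=> // a y z -> ->.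
  by rewrite scaler0 addr0.
move=> /lspan_cons[a [w [/IHs[c ->] ->]]].
by exists (fun i => if i is j.+1 then c j else a); rewrite big_ord_recl.
Qed.

Definition finitely_generated N : Prop :=
  exists2 s, (forall x, x \in s -> N x) & forall x, N x -> lspan s x.

End LinearSpan.

Definition noetherian (R : comNzRingType) : Prop :=
  forall I : set R^o, submodule I -> finitely_generated I.

Lemma noetherian_field (F : fieldType) : noetherian F.
Proof.
move=> I subI; have [[x Ix x0] | nI] := pselect (exists2 x, I x & x != 0).
  exists [:: x] => [y|y _]; first by rewrite inE => /eqP ->.
  rewrite -[y](divfK x0); apply: (submoduleZ (y / x)) (lspan_mem (mem_head _ _)).
  exact: lspan_submodule.
exists [::] => // x Ix; have -> : x = 0.
  by apply/eqP; apply: contrapT => /negP x0; apply: nI; exists x.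
by case: (lspan_submodule ([::] : seq F^o)).
Qed.

(** Induction on s = x :: s'.  The coefficients of x in elements of N form a
    finitely generated ideal; lifts of its generators to N, together with
    generators of the elements of N in the span of s', generate N. *)
Lemma noetherian_submodule (R : comNzRingType) (V : lmodType R) (s : seq V)
    (N : set V) :
  noetherian R -> submodule N -> (forall x, N x -> lspan s x) ->
  finitely_generated N.
Proof.
move=> noeR; elim: s N => [|x s IHs] N subN Ns.
  by exists [::].
pose J : set R^o := [set a | exists2 v, N v & lspan s (v - (a : R) *: x)].
have span_s := lspan_submodule s.
have subJ : submodule J.
  split=> [|a b c [v Nv vE] [w Nw wE]].
    exists 0; first by case: subN.
    by rewrite scale0r subr0; case: span_s.
  exists (a *: v + w); first by case: subN => _; apply.
  have -> : a *: v + w - (a *: b + c) *: x = a *: (v - b *: x) + (w - c *: x).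
    rewrite scalerDl opprD scalerBr scalerA; rewrite -!addrA; congr (_ + _).
    by rewrite addrCA.
  by case: span_s => _; apply.
have [Js JJ Jspan] := noeR J subJ.
pose N' : set V := [set v | N v /\ lspan s v].
have subN' : submodule N'.
  split; first by split; [case: subN | case: span_s].
  move=> a v w [Nv sv] [Nw sw].
  by split; [case: subN => _; apply | case: span_s => _; apply].
have [t tN' N't] := IHs N' subN' (fun v h => h.2).
have [u uN uJ] : exists2 u : seq V, (forall v, v \in u -> N v) &
    forall a, a \in Js -> exists2 v, v \in u & lspan s (v - (a : R) *: x).
  elim: Js JJ {Jspan} => [|a Js IH] JJ; first by exists [::].
  have [|u uN uJ] := IH; first by move=> b bJ; apply: JJ; rewrite inE bJ orbT.
  have [v Nv va] : J a by apply: JJ; rewrite inE eqxx.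
  exists (v :: u) => [w|b].
    by rewrite inE => /orP[/eqP ->//|/uN].
  rewrite inE => /orP[/eqP ->|/uJ[w wu sw]]; first by exists v; rewrite ?mem_head.
  by exists w => //; rewrite inE wu orbT.
have span_ut := lspan_submodule (u ++ t).
exists (u ++ t) => [v|v Nv]; first by rewrite mem_cat => /orP[/uN|/tN'[]].
have [a [w [sw vE]]] := lspan_cons (Ns v Nv).
have Ja : J a by exists v => //; rewrite vE addrC addKr.
have [v0 uv0 sv0] : exists2 v0, lspan u v0 & lspan s (v0 - a *: x).
  apply: (Jspan a Ja [set a : R^o | exists2 v0, lspan u v0 &
      lspan s (v0 - (a : R) *: x)]) => [|b /uJ[v0 v0u sv0]]; last first.
    by exists v0 => //; apply: lspan_mem.
  split=> [|b c d [v1 u1 s1] [v2 u2 s2]].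
    exists 0; first by case: (lspan_submodule u).
    by rewrite scale0r subr0; case: span_s.
  exists (b *: v1 + v2); first by case: (lspan_submodule u) => _; apply.
  have -> : b *: v1 + v2 - (b *: c + d) *: x = b *: (v1 - c *: x) + (v2 - d *: x).
    rewrite scalerDl opprD scalerBr scalerA; rewrite -!addrA; congr (_ + _).
    by rewrite addrCA.
  by case: span_s => _; apply.
have Nv0 : N v0 by apply: uv0.
rewrite -(subrK v0 v); apply: (submoduleD span_ut).
  apply: (lspan_mono (s := t)); first by move=> y; rewrite mem_cat orbC => ->.
  apply: N't; split; first exact: submoduleB.
  have -> : v - v0 = w - (v0 - a *: x) by rewrite vE opprB addrA [w + _]addrC.
  exact: (submoduleB span_s).
by apply: lspan_mono uv0 => y; rewrite mem_cat => ->.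
Qed.

(** Bring elements of I whose leading coefficients generate the ideal L of all
    leading coefficients to a common degree d.  Together with generators of
    the R-module of the elements of I of degree less than d they generate I. *)
Theorem hilbert_basis (R : comNzRingType) : noetherian R -> noetherian {poly R}.
Proof.
move=> noeR I subI.
have IM (c Q : {poly R}) : I Q -> I (c * Q) by move=> IQ;
  apply: (submoduleZ c subI).
have IZ (c : R) (Q : {poly R}) : I Q -> I (c *: Q).
  by move=> IQ; rewrite -mul_polyC; apply: IM.
(* The size is at most d + 1, not equal to it, so that c = 0 is allowed. *)
pose has_coef (N : set {poly R}) d (c : R) :=
  exists2 Q, N Q & (size Q <= d.+1)%N /\ Q`_d = c.
have shift (N : set {poly R}) d e c : (forall c Q, N Q -> N (c * Q)) ->
    has_coef N d c -> has_coef N (d + e)%N c.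
  move=> NM [Q NQ [sQ Qd]]; exists ('X^e * Q); first exact: NM.
  rewrite coefXnM ltnNge leq_addl /= addnK; split=> //.
  rewrite mulrC; have [-> | Q0] := eqVneq Q 0; first by rewrite mul0r size_poly0.
  by rewrite size_mulXn // addnC -addSn leq_add2r.
pose L : set R^o := [set c | exists d, has_coef I d c].
have subL : submodule L.
  split.
    exists 0%N, 0; first by case: subI.
    by rewrite size_poly0 coef0.
  move=> a b c [d hb] [e hc].
  have [Q IQ [sQ Qd]] := shift _ _ e _ IM hb.
  have [P IP [sP Pd]] := shift _ _ d _ IM hc; rewrite (addnC e) in sP Pd.
  exists (d + e)%N, (a *: Q + P); last split.
  - by apply: (submoduleD subI) => //; apply: IZ.
  - rewrite (leq_trans (size_polyD _ _)) // geq_max sP andbT.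
    exact: leq_trans (size_scale_leq _ _) sQ.
  - by rewrite coefD coefZ Qd Pd.
have [cs csL Lcs] := noeR L subL.
(* Multiplying by powers of X brings the chosen elements to one degree d. *)
have [d [Ps PsI Pscs]] : exists d, exists2 Ps : seq {poly R},
    (forall Q, Q \in Ps -> I Q) & forall c, c \in cs -> has_coef [set` Ps] d c.
  elim: cs csL {Lcs} => [|c cs IH] csL; first by exists 0%N, [::].
  have [|d [Ps PsI Pscs]] := IH.
    by move=> b bcs; apply: csL; rewrite inE bcs orbT.
  have [e he] : L c by apply: csL; rewrite inE eqxx.
  have [P IP hP] := shift _ _ d _ IM he; rewrite addnC in hP.
  exists (d + e)%N, (P :: [seq 'X^e * Q | Q <- Ps]).
    by move=> Q; rewrite inE => /orP[/eqP ->//|/mapP[Q' /PsI IQ' ->]]; apply: IM.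
  move=> b; rewrite inE => /orP[/eqP ->|/Pscs[Q QPs [sQ Qd]]].
    by exists P => //=; rewrite mem_head.
  exists ('X^e * Q); first by rewrite /= inE map_f ?orbT.
  rewrite coefXnM ltnNge leq_addl /= addnK; split=> //.
  rewrite mulrC; have [-> | Q0] := eqVneq Q 0; first by rewrite mul0r size_poly0.
  by rewrite size_mulXn // addnC -addSn leq_add2r.
(* The elements of I of degree less than d form a finitely generated R-module. *)
pose N : set {poly R} := [set Q | I Q /\ (size Q <= d)%N].
have subN : submodule N.
  split; first by split; [case: subI | rewrite size_poly0].
  move=> a P Q [IP sP] [IQ sQ]; split;
    first by apply: (submoduleD subI) => //; apply: IZ.
  rewrite (leq_trans (size_polyD _ _)) // geq_max sQ andbT.
  exact: leq_trans (size_scale_leq _ _) sP.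
have [] := @noetherian_submodule R {poly R} [seq 'X^i | i <- iota 0 d] N noeR
  subN.
  move=> P [_ sP]; have -> : P = \sum_(i < d) P`_i *: 'X^i.
    rewrite -[LHS]coefK (poly_def (size P)).
    rewrite -(subnKC sP) big_split_ord /= [X in _ + X]big1 ?addr0 // => i _.
    by rewrite nth_default ?scale0r ?leq_addr.
  have sub := @lspan_submodule R {poly R} [seq 'X^i | i <- iota 0 d].
  apply: (submodule_sum _ sub) => i _; apply: (submoduleZ _ sub).
  by apply: lspan_mem; apply: map_f; rewrite mem_iota /=.
move=> Qs QsN NQs.
pose G : seq ({poly R}^o) := Ps ++ Qs.
have subG : submodule (lspan G) := lspan_submodule G.
exists G => [P|P]; first by rewrite mem_cat => /orP[/PsI|/QsN[]].
have GM (c Q : {poly R}) : lspan G Q ->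
  lspan G (c * Q) by exact: (submoduleZ c subG).
have [n] := ubnP (size P); elim: n P => // n IHn P sPn IP.
have [sPd | dsP] := leqP (size P) d.
  apply: (NQs P (conj IP sPd) (lspan G)) => [|Q QQs]; last first.
    by apply: lspan_mem; rewrite mem_cat QQs orbT.
  split=> [|a Q Q' GQ GQ']; first by case: subG.
  by apply: (submoduleD subG) => //; rewrite -mul_polyC; apply: GM.
have lP : L (lead_coef P).
  exists (size P).-1, P => //; split=> //.
  by rewrite prednK // (leq_trans _ dsP).
have [Q GQ [sQ Qd]] : has_coef (lspan G) d (lead_coef P).
  apply: (Lcs _ lP [set c | has_coef (lspan G) d c]) => [|c /Pscs[Q QPs hQ]];
    last first.
    by exists Q => //; apply: lspan_mem; rewrite mem_cat QPs.
  split=> [|a b c [Q GQ [sQ Qd]] [Q' GQ' [sQ' Q'd]]].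
    by exists 0; [case: subG | rewrite size_poly0 coef0].
  exists (a *: Q + Q'); last split.
  - by apply: (submoduleD subG) => //; rewrite -mul_polyC; apply: GM.
  - rewrite (leq_trans (size_polyD _ _)) // geq_max sQ' andbT.
    exact: leq_trans (size_scale_leq _ _) sQ.
  - by rewrite coefD coefZ Qd Q'd.
have IQ : I Q by apply: GQ => // Q'; rewrite mem_cat => /orP[/PsI|/QsN[]].
pose e := ((size P).-1 - d)%N.
have eE : (size P).-1 = (d + e)%N by rewrite subnKC // -ltnS (ltn_predK dsP).
rewrite -(subrK ('X^e * Q) P); apply: (submoduleD subG); last exact: GM.
apply: IHn; last by apply: (submoduleB subI) => //; apply: IM.
rewrite -ltnS; apply: leq_trans sPn; rewrite ltnS -(ltn_predK dsP) ltnS.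
apply/leq_sizeP => j; rewrite eE => dj; rewrite coefB coefXnM.
rewrite ltnNge (leq_trans (leq_addl d e) dj) /=.
have [dej | jde | <-] := ltngtP (d + e)%N j.
- rewrite [X in X - _]nth_default ?[X in _ - X]nth_default ?subrr //.
    by rewrite (leq_trans sQ) // ltn_subRL addnC.
  by rewrite -(ltn_predK dsP) eE.
- by rewrite ltnNge dj in jde.
- by rewrite addnK Qd -eE subrr.
Qed.

Section FrobeniusRestriction.
Variables (p : nat) (R : comNzRingType) (chR : p \in [pchar R]).

(** Scalars act through the Frobenius, so that t times the p-th power of y is
    the p-th power of g(t) y: sets of p-th powers can be submodules. *)
Definition frobenius_module (T : comNzRingType) (g : {rmorphism T -> R}) :
    lmodType T :=
  restriction (pFrobenius_aut chR \o g) R^o.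

Lemma frobenius_moduleZ (T : comNzRingType) (g : {rmorphism T -> R}) (t : T)
    (x : frobenius_module g) : t *: x = (g t) ^+ p * (x : R) :> R.
Proof. by rewrite -(pFrobenius_autE chR). Qed.

(** The ring T is an iterated polynomial ring over k, so it is noetherian by
    hilbert_basis.  The last clause is F-finiteness: the image of T is spanned
    over its p-th powers by the monomials in s with exponents less than p,
    because k is perfect. *)
Lemma noetherian_presentation (k : closedFieldType) (i : {rmorphism k -> R})
    (s : seq R) :
  exists (T : comNzRingType) (g : {rmorphism T -> R}) (xs : seq R),
  [/\ noetherian T,
      forall x, x \in s -> exists t, g t = x,
      forall l, exists t, g t = i l,
      forall S : set R, (forall l, S (i l)) -> (forall x, x \in s -> S x) ->
        (forall x y, S x -> S y -> S (x + y)) ->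
        (forall x y, S x -> S y -> S (x * y)) -> forall t, S (g t)
    & forall t, lspan (xs : seq (frobenius_module g)) (g t)].
Proof.
have p_gt0 : (0 < p)%N := prime_gt0 (pcharf_prime chR).
elim: s => [|x s [T [g [xs [noeT gs gk gen span]]]]].
  exists k, i, [:: 1]; split=> //; first exact: noetherian_field.
    by move=> l; exists l.
  move=> l; have [r rE] := ex_pth_root l p_gt0.
  have -> : i l = r *: (1 : frobenius_module i).
    by rewrite frobenius_moduleZ -rE rmorphXn mulr1.
  by apply: (submoduleZ _ (lspan_submodule _)); apply: lspan_mem;
    rewrite mem_head.
have cgx : commr_rmorph g x by move=> a; apply: mulrC.
pose h : {rmorphism {poly T} -> R} := horner_morph cgx.
have hC c : h c%:P = g c by exact: horner_morphC.
have hX : h 'X = x by exact: horner_morphX.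
pose xs' : seq R := [seq x ^+ r * y | y <- xs, r <- iota 0 p].
exists {poly T}, h, xs'; split.
- exact: hilbert_basis.
- move=> y; rewrite inE => /orP[/eqP ->|/gs[t tE]]; first by exists 'X.
  by exists t%:P; rewrite hC.
- by move=> l; have [t tE] := gk l; exists t%:P; rewrite hC.
- move=> S Sk Sx SD SM; have Sg t : S (g t).
    by apply: gen => // y ys; apply: Sx; rewrite inE ys orbT.
  elim/poly_ind=> [|P c IHP]; first by rewrite rmorph0 -(rmorph0 i).
  rewrite rmorphD rmorphM hC hX; apply: SD => //; apply: SM => //.
  by apply: Sx; rewrite mem_head.
- have sub := lspan_submodule (xs' : seq (frobenius_module h)).
  (* The factor x ^+ (p * (j / p)) of x ^+ j is absorbed in the scalar. *)
  have monom j (y : R) : lspan (xs : seq (frobenius_module g)) y ->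
      lspan (xs' : seq (frobenius_module h)) (y * x ^+ j).
    move=> sy.
    apply: (sy [set y : frobenius_module g |
      lspan (xs' : seq (frobenius_module h)) ((y : R) * x ^+ j)]).
      split=> [|a u v su sv]; first by rewrite /= mul0r; case: sub.
      have [_ /(_ a%:P _ _ su sv)] := sub; congr (lspan _ _).
      by rewrite frobenius_moduleZ hC mulrDl frobenius_moduleZ mulrA.
    move=> z zxs /=.
    have -> : z * x ^+ j =
        'X^(j %/ p) *: (x ^+ (j %% p) * z : frobenius_module h).
      rewrite frobenius_moduleZ rmorphXn hX -exprM mulrA -exprD mulrC.
      by rewrite -divn_eq.
    apply: (submoduleZ _ sub); apply: lspan_mem.
    by apply: allpairs_f => //; rewrite mem_iota ltn_pmod.
  move=> P; rewrite -[P]coefK poly_def rmorph_sum /=.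
  apply: (submodule_sum _ sub) => j _.
  by rewrite -mul_polyC rmorphM hC rmorphXn hX; apply: monom.
Qed.

End FrobeniusRestriction.

(** * The degree filtration and its behaviour under p-th roots *)

Section DegreeFiltration.
Variables (k : fieldType) (A : idomainAlgType k) (s : seq A).
Hypothesis s_gen : forall S : subalgClosed A,
  {subset s <= S} -> forall a : A, a \in S.

(** Products of at most d generators, since 1 is allowed as a factor. *)
Fixpoint words d : seq A :=
  if d is d'.+1 then [seq x * w | x <- 1 :: s, w <- words d'] else [:: 1].

Lemma words0P w : w \in words 0 -> w = 1.
Proof. by rewrite inE => /eqP. Qed.

Lemma wordsSP d w : w \in words d.+1 ->
  exists x u, [/\ x \in 1 :: s, u \in words d & w = x * u].
Proof. by case/allpairsP=> -[x u] [xs ud ->]; exists x, u. Qed.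

Lemma wordsS d x u : x \in 1 :: s -> u \in words d -> x * u \in words d.+1.
Proof. by move=> xs ud; apply: allpairs_f. Qed.

Arguments words : simpl never.

Definition deg_le d : set A := lspan (words d).

Lemma deg_le_submodule d : submodule (deg_le d).
Proof. exact: lspan_submodule. Qed.

Lemma words1 d : 1 \in words d.
Proof.
elim: d => [|d IHd]; first by rewrite mem_head.
by rewrite -[1](mulr1 1); apply: wordsS; rewrite ?mem_head.
Qed.

Lemma words_leq d e : (d <= e)%N -> {subset words d <= words e}.
Proof.
move=> /subnKC <-; elim: (e - d)%N => [|n IHn] w wd; first by rewrite addn0.
by rewrite addnS -[w]mul1r; apply: wordsS; rewrite ?mem_head ?IHn.
Qed.

Lemma deg_le_leq d e a : (d <= e)%N -> deg_le d a -> deg_le e a.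
Proof. by move=> /words_leq; apply: lspan_mono. Qed.

Lemma wordsM d e v w : v \in words d -> w \in words e ->
  v * w \in words (d + e)%N.
Proof.
move=> + we; elim: d v => [|d IHd] v; first by move=> /words0P ->; rewrite mul1r.
move=> /wordsSP[x [u [xs ud ->]]].
by rewrite -mulrA addSn; apply: wordsS => //; apply: IHd.
Qed.

Lemma deg_leM d e a b : deg_le d a -> deg_le e b -> deg_le (d + e)%N (a * b).
Proof.
have [de0 deL] := deg_le_submodule (d + e)%N.
move=> da eb; apply: (da [set a | deg_le (d + e)%N (a * b)]) => [|v vd /=].
  split=> [|l x y xb yb]; first by rewrite /= mul0r.
  by rewrite /= mulrDl -scalerAl; apply: deL.
apply: (eb [set b | deg_le (d + e)%N (v * b)]) => [|w we /=].
  split=> [|l x y xb yb]; first by rewrite /= mulr0.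
  by rewrite /= mulrDr -scalerAr; apply: deL.
by apply: lspan_mem; apply: wordsM.
Qed.

Lemma deg_le1 d : deg_le d 1.
Proof. by apply: lspan_mem; apply: words1. Qed.

Lemma deg_le_gen x : x \in s -> deg_le 1 x.
Proof.
move=> xs; apply: lspan_mem; rewrite -[x]mulr1.
by apply: wordsS; rewrite ?mem_head // inE xs orbT.
Qed.

Lemma deg_le_ex a : exists d, deg_le d a.
Proof.
apply: (generation_ind s_gen (P := [set a | exists d, deg_le d a])) a =>
  [|l u v||].
- by exists 0%N; apply: deg_le1.
- move=> [d du] [e ev]; exists (maxn d e).
  have [_ L] := deg_le_submodule (maxn d e); apply: L.
    exact: deg_le_leq (leq_maxl _ _) du.
  exact: deg_le_leq (leq_maxr _ _) ev.
- by move=> u v [d du] [e ev]; exists (d + e)%N; apply: deg_leM.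
- by move=> x xs; exists 1%N; apply: deg_le_gen.
Qed.

Lemma deg_le_bound (I : finType) (F : I ->
  A) : exists d, forall i, deg_le d (F i).
Proof.
pose d i := projT1 (cid (deg_le_ex (F i))).
exists (\max_i d i)%N => i; apply: (deg_le_leq (leq_bigmax i)).
by rewrite /d; case: cid.
Qed.

(** The constant c bounds the degrees of the images of the generators. *)
Lemma deg_le_der (D : derivation A) : exists c, forall d a,
  deg_le d a -> deg_le (d + c)%N (D a).
Proof.
have [c cP] : exists c, forall x, x \in 1 :: s -> deg_le c (D x).
  have [c cP] := deg_le_bound (fun i : 'I_(size (1 :: s)) =>
    D (nth 0 (1 :: s) i)).
  exists c => x xs; move: (xs); rewrite -index_mem => h.
  by have := cP (Ordinal h); rewrite nth_index.
exists c => d a da; have [de0 deL] := deg_le_submodule (d + c)%N.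
apply: (da [set a | deg_le (d + c)%N (D a)]) => [|w].
  split=> [|l u v du dv]; first by rewrite /= linear0.
  by rewrite /= linearP; apply: deL.
elim: d w {a da de0 deL} => [|d IHd] w.
  by move=> /words0P ->; apply: cP; exact: mem_head.
move=> /wordsSP[x [u [xs ud ->]]]; rewrite /= der_leibniz.
apply: (submoduleD (deg_le_submodule _)).
  apply: (@deg_le_leq (c + d)); first by rewrite addnC leq_add2r.
  by apply: deg_leM; [exact: cP | exact: lspan_mem].
rewrite addSn -add1n; apply: deg_leM; last exact: IHd.
move: xs; rewrite inE => /orP[/eqP ->|]; [exact: deg_le1 | exact: deg_le_gen].
Qed.

End DegreeFiltration.

(** Let R be the Rees algebra of the filtration, that is the subring of the
    polynomials P of A[X] whose coefficient of X^j has degree at most j for all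
    j; it is generated over k by X and the x X with x in s.  If a ^+ p has
    degree at most p d, then y = a X^d satisfies y ^+ p in R.  The p-th powers
    that lie in R form a module over R acting through the Frobenius, which is
    finitely generated as R is noetherian and F-finite, say by p-th powers of
    y_1, ..., y_r.  By injectivity of the Frobenius, y is a combination of the
    y_i over R, and any C that bounds the degrees of all coefficients of the y_i
    is suitable. *)
Lemma deg_le_pth_root (k : closedFieldType) p (kp : p \in [pchar k])
    (A : idomainAlgType k) (s : seq A)
    (s_gen : forall S : subalgClosed A, {subset s <= S} ->
      forall a : A, a \in S) :
  exists C, forall d a, deg_le s (p * d)%N (a ^+ p) -> deg_le s (d + C)%N a.
Proof.
have Xp := poly_pchar kp A.
pose i : {rmorphism k -> {poly A}} := polyC \o in_alg A.
have iE l : i l = l%:A%:P by [].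
have [T [g [xs [noeT gs gk gen span]]]] :=
  noetherian_presentation Xp i ('X :: [seq x%:P * 'X | x <- s]).
(* The image of g is contained in the Rees algebra, and contains it by gim. *)
have gdeg t j : deg_le s j (g t)`_j.
  move: t j; apply: (gen [set P | forall j, deg_le s j P`_j]).
  - move=> l j; rewrite iE coefC; case: eqP => [->|_].
      by apply: (submoduleZ _ (deg_le_submodule s _)); exact: deg_le1.
    by case: (deg_le_submodule s j).
  - move=> P; rewrite inE => /orP[/eqP ->|/mapP[x xs' ->]] j.
      rewrite coefX; case: eqP => [->|_]; first exact: deg_le1.
      by case: (deg_le_submodule s j).
    rewrite coefCM coefX; case: eqP => [->|_].
      by rewrite mulr1; apply: deg_le_gen.
    by rewrite mulr0; case: (deg_le_submodule s j).
  - by move=> P Q hP hQ j; rewrite coefD;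
    apply: (submoduleD (deg_le_submodule s _)).
  - move=> P Q hP hQ j; rewrite coefM.
    apply: (submodule_sum _ (deg_le_submodule s _)) => l _.
    apply: (@deg_le_leq _ _ s (l + (j - l))%N); last exact: deg_leM.
    by rewrite subnKC // -ltnS.
have gim d a : deg_le s d a -> exists t, g t = a%:P * 'X^d.
  move=> da; apply: (da [set a | exists t, g t = a%:P * 'X^d]) => [|w].
    split=> [|l u v [t tE] [t' t'E]]; first by exists 0; rewrite rmorph0 mul0r.
    have [r rE] := gk l; exists (r * t + t').
    by rewrite rmorphD rmorphM tE t'E rE iE mulrA -mulrDl -polyCM -polyCD
      mulr_algl.
  have [X XE] : exists t, g t = 'X by apply: gs; rewrite mem_head.
  elim: d w {a da} => [|d IHd] w.
    by move=> /words0P ->; exists 1; rewrite rmorph1 mul1r.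
  move=> /wordsSP[x [u [xs' /IHd[t tE] ->]]].
  move: xs'; rewrite inE => /orP[/eqP ->|xs'].
    by exists (X * t); rewrite rmorphM XE tE mul1r exprS mulrCA.
  have [r rE] : exists t, g t = x%:P * 'X.
    apply: gs; rewrite inE; apply/orP; right.
    exact: (map_f (fun x => x%:P * 'X)).
  by exists (r * t); rewrite rmorphM rE tE polyCM exprS mulrACA.
pose V := frobenius_module Xp g.
pose N : set V := [set z |
  (exists t, g t = z) /\ exists y : {poly A}, y ^+ p = z].
have subN : submodule N.
  split; first by split; exists 0;
    rewrite ?rmorph0 ?expr0n // gtn_eqF ?(prime_gt0 (pcharf_prime kp)).
  move=> t u v [[tu tuE] [yu yuE]] [[tv tvE] [yv yvE]]; split.
    exists (t ^+ p * tu + tv).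
    by rewrite rmorphD rmorphM rmorphXn tuE tvE -frobenius_moduleZ.
  exists (g t * yu + yv); rewrite frobenius_moduleZ -yuE -yvE -exprMn.
  by rewrite -!(pFrobenius_autE Xp) rmorphD.
have [|zs zsN Nzs] := @noetherian_submodule T V xs N noeT subN.
  by move=> z [[t <-] _]; apply: span.
pose M C : set V := [set z | exists2 y : {poly A}, y ^+ p = z &
  forall j, deg_le s (j + C)%N y`_j].
have [C CP] : exists C, forall z, z \in zs -> M C z.
  elim: zs zsN {Nzs} => [|z zs IH] zsN; first by exists 0%N.
  have [|C CP] := IH; first by move=> x xzs; apply: zsN; rewrite inE xzs orbT.
  have [_ [y yE]] : N z by apply: zsN; rewrite mem_head.
  have [c cP] := deg_le_bound s_gen (fun i : 'I_(size y) => y`_i).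
  exists (C + c)%N => x; rewrite inE => /orP[/eqP ->|/CP[y' y'E hy']]; last first.
    by exists y' => // j; apply: deg_le_leq (hy' j); rewrite leq_add2l leq_addr.
  exists y => // j; have [jy | yj] := ltnP j (size y).
    by apply: deg_le_leq (cP (Ordinal jy)); rewrite addnA leq_addl.
  by rewrite nth_default //; case: (deg_le_submodule s (j + (C + c))%N).
(* The degree bound for coefficients is a property of the whole span of the
   generators, so it holds for the p-th power of a X^d. *)
exists C => d a da.
have : M C ((a%:P * 'X^d) ^+ p).
  apply: (Nzs ((a%:P * 'X^d) ^+ p) _ (M C)) => //.
    split; last by exists (a%:P * 'X^d).
    by have [t tE] := gim _ _ da; exists t;
      rewrite tE exprMn -polyC_exp -exprM mulnC.
  split=> [|t u v [yu <- hu] [yv <- hv]].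
    exists 0; first by rewrite expr0n gtn_eqF // (prime_gt0 (pcharf_prime kp)).
    by move=> j; rewrite coef0; case: (deg_le_submodule s (j + C)%N).
  exists (g t * yu + yv).
    rewrite frobenius_moduleZ -exprMn.
    by rewrite -!(pFrobenius_autE Xp) rmorphD.
  move=> j; rewrite coefD; apply: (submoduleD (deg_le_submodule s _)) => //.
  rewrite coefM; apply: (submodule_sum _ (deg_le_submodule s _)) => l _.
  apply: (@deg_le_leq _ _ s (l + (j - l + C))%N); last exact: deg_leM.
  by rewrite addnA subnKC // -ltnS.
move=> [y /(pth_inj Xp) yE /(_ d)]; rewrite yE.
by rewrite coefCM coefXn eqxx mulr1.
Qed.

(** * The formula of Hochschild *)

(** The inductive step common to the Leibniz formula for the iterates of a
    derivation and to the differentiation of the polynomials u n below. *)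
Lemma pascal_sum (V : zmodType) (F : nat -> nat -> V) n :
  \sum_(i < n.+1) (F i.+1 (n - i)%N + F i (n - i).+1%N) *+ 'C(n, i) =
  \sum_(i < n.+2) F i (n.+1 - i)%N *+ 'C(n.+1, i).
Proof.
rewrite [RHS]big_ord_recl /= bin0 subn0.
under [in RHS]eq_bigr => i _ do rewrite /bump /= add1n binS subSS mulrnDr.
rewrite [in RHS]big_split /= addrA.
under eq_bigr => i _ do rewrite mulrnDl.
rewrite big_split /= addrC; congr (_ + _).
have -> : F 0 n.+1 *+ 1 + \sum_(i < n.+1) F i.+1 (n - i)%N *+ 'C(n, i.+1) =
  \sum_(i < n.+2) F i (n.+1 - i)%N *+ 'C(n, i)
    by rewrite [RHS]big_ord_recl /= bin0 subn0.
rewrite [RHS]big_ord_recr /= bin_small // mulr0n addr0.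
by apply: eq_bigr => i _; rewrite subSn // -ltnS.
Qed.

Section Hochschild.
Variables (k : fieldType) (p : nat) (kp : p \in [pchar k]).
Variables (A : idomainAlgType k) (D : derivation A).

Let Ap : p \in [pchar A] := pchar_alg kp A.
Let p_gt0 : (0 < p)%N := prime_gt0 (pcharf_prime kp).

Lemma iter_der_linear n : linear (iter n D).
Proof. by elim: n => //= n IHn l x y; rewrite !iterS IHn linearP. Qed.

Lemma iter_der_leibniz n x y : iter n D (x * y) =
  \sum_(i < n.+1) (iter i D x * iter (n - i) D y) *+ 'C(n, i).
Proof.
elim: n => [|n IHn]; first by rewrite big_ord1.
rewrite iterS IHn linear_sum.
rewrite -(pascal_sum (fun i j => iter i D x * iter j D y)); apply: eq_bigr => i _.
by rewrite linearMn der_leibniz.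
Qed.

Lemma iter_p_leibniz x y :
  iter p D (x * y) = iter p D x * y + x * iter p D y.
Proof.
rewrite iter_der_leibniz.
rewrite (sum_pchar_bin (fun i =>
  iter i D x * iter (p - i)%N D y) Ap) subn0 subnn /=.
by rewrite addrC.
Qed.

(** In characteristic p the p-th iterate of a derivation is a derivation. *)
Definition der_p : derivation A :=
  @Derivation k A (linear_of (iter_der_linear p)) iter_p_leibniz.

Section Formula.
Variable a : A.

Let DX (P : {poly A}) : {poly A} := map_poly D P.
Let E (P : {poly A}) : {poly A} := DX P + a%:P * 'X * P.
Let u n : {poly A} := iter n E 1.

Let DX_coef P i : (DX P)`_i = D P`_i.
Proof. by rewrite coef_map_id0 ?linear0. Qed.

Let DXD P Q : DX (P + Q) = DX P + DX Q.
Proof. by apply/polyP => i; rewrite !(coefD, DX_coef) linearD. Qed.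

Let DXM P Q : DX (P * Q) = DX P * Q + P * DX Q.
Proof.
apply/polyP => i; rewrite coefD DX_coef !coefM linear_sum -big_split /=.
by apply: eq_bigr => j _; rewrite der_leibniz !DX_coef.
Qed.

Let DXC c : DX c%:P = (D c)%:P.
Proof. by apply/polyP => i; rewrite DX_coef !coefC; case: eqP;
  rewrite ?linear0. Qed.

Let DX_deriv P : (DX P)^`() = DX P^`().
Proof. by apply/polyP => i; rewrite coef_deriv !DX_coef coef_deriv linearMn. Qed.

Let ED P Q : E (P + Q) = E P + E Q.
Proof. by rewrite /E DXD mulrDr addrACA. Qed.

Let E0 : E 0 = 0.
Proof. by rewrite /E mulr0 addr0; apply/polyP => i;
  rewrite DX_coef coef0 linear0. Qed.

Let EMn P n : E (P *+ n) = E P *+ n.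
Proof. by elim: n => [|n IHn]; rewrite ?mulr0n ?E0 // !mulrS ED IHn. Qed.

Let E_sum (I : Type) (r : seq I) (F : I -> {poly A}) :
  E (\sum_(i <- r) F i) = \sum_(i <- r) E (F i).
Proof. exact: (big_morph E ED E0). Qed.

Let EC c P : E (c%:P * P) = (D c)%:P * P + c%:P * E P.
Proof. by rewrite /E DXM DXC mulrDr addrA; congr (_ + _); rewrite mulrCA. Qed.

(* The derivative of u n is the binomial sum of the F i (n - i); the value 0 at
   i = 0 lets pascal_sum apply as it stands. *)
Let F i j : {poly A} := if i is i'.+1 then (iter i' D a)%:P * u j else 0.

Let u_deriv n : (u n)^`() = \sum_(i < n.+1) F i (n - i)%N *+ 'C(n, i).
Proof.
elim: n => [|n IHn].
  by rewrite big_ord1 /u /= -[1]/(1%:P) derivC.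
rewrite -(pascal_sum F) /u iterS -/(u n) /E derivD DX_deriv derivM.
rewrite derivM derivC mul0r add0r derivX mulr1 addrCA -/(E _) IHn E_sum.
rewrite big_ord_recl [in RHS]big_ord_recl subn0 /= mul0rn E0 add0r bin0 addr0.
congr (_ + _); apply: eq_bigr => i _.
by rewrite EMn EC.
Qed.

Let u_deriv_p : (u p)^`() = (iter p.-1 D a)%:P.
Proof.
rewrite u_deriv (sum_pchar_bin (fun i => F i (p - i)%N) (poly_pchar kp A)).
by rewrite add0r subnn -(prednK p_gt0) /= mulr1.
Qed.

Let size_u n : (size (u n) <= n.+1)%N /\ (u n)`_n = a ^+ n.
Proof.
elim: n => [|n [sn cn]]; first by rewrite size_poly1 coefC.
have szD : (size (DX (u n)) <= n.+1)%N.
  by apply/leq_sizeP => j /(leq_sizeP _ _ sn) h; rewrite DX_coef h linear0.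
rewrite /u iterS -/(u n) /E; split.
  rewrite (leq_trans (size_polyD _ _)) // geq_max (leq_trans szD) //=.
  rewrite -mulrA mul_polyC (leq_trans (size_scale_leq _ _)) // mulrC.
  have [->|u0] := eqVneq (u n) 0; first by rewrite mul0r size_poly0.
  by rewrite size_mulX.
rewrite coefD (leq_sizeP _ _ szD) // add0r -mulrA coefCM coefXM /= cn.
by rewrite exprS.
Qed.

Let u_coef0 n : (u n.+1)`_0 = 0.
Proof.
elim: n => [|n IHn].
  by rewrite /u /= /E coefD DX_coef coefC /= der1 add0r -mulrA coefCM coefXM
    mulr0.
by rewrite /u iterS -/(u _) /E coefD DX_coef IHn linear0 add0r -mulrA coefCM
  coefXM mulr0.
Qed.

Let horner1_D P : (DX P).[1] = D P.[1].
Proof.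
rewrite (@horner_coef_wide _ (size P)) ?size_poly // horner_coef linear_sum.
by apply: eq_bigr => i _; rewrite DX_coef expr1n !mulr1.
Qed.

Let u_p1 : (u p).[1] = iter p.-1 D a + a ^+ p.
Proof.
have [sz cp] := size_u p.
have coefS i : (u p)`_i.+1 *+ i.+1 = (iter p.-1 D a)%:P`_i.
  by rewrite -coef_deriv u_deriv_p.
have p1 := prime_gt1 (pcharf_prime kp).
rewrite (horner_coef_wide _ sz).
under eq_bigr => i _ do rewrite expr1n mulr1.
rewrite big_ord_recr /= cp; congr (_ + _).
rewrite -(big_mkord xpredT (fun i => (u p)`_i)) -{1}(prednK p_gt0).
rewrite big_nat_recl //= -{1}(prednK p_gt0) u_coef0 add0r.
have p2 : (0 < p.-1)%N by rewrite -subn1 subn_gt0.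
rewrite -{1}(prednK p2) big_nat_recl //= [X in _ + X]big_nat big1 ?addr0.
  by have := coefS 0%N; rewrite coefC /= mulr1n.
move=> i /andP[_ ip]; have := coefS i.+1; rewrite coefC /= => /eqP.
rewrite -mulr_natr mulf_eq0 => /orP[/eqP //|].
rewrite -(dvdn_pcharf Ap) => /dvdn_leq -/(_ isT); rewrite leqNgt.
by rewrite -2!ltnS !prednK // in ip; rewrite ip.
Qed.

Lemma iter_der_log f n : D f = a * f -> iter n D f = (u n).[1] * f.
Proof.
move=> Df; elim: n => [|n IHn]; first by rewrite /u /= hornerC mul1r.
rewrite iterS IHn der_leibniz Df /u iterS -/(u n) /E hornerD horner1_D.
by rewrite mulrDl !hornerM hornerC hornerX mulr1 mulrCA mulrA.
Qed.

(** Introduce an indeterminate X and the operator E = D + a X on A[X], with D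
    acting on coefficients, and let u_n = E^n(1); then D^n f = u_n(1) f.  The
    derivative of u_n with respect to X is
      sum_(j < n) binomial(n, j + 1) D^j(a) u_(n - j - 1),
    which for n = p reduces to the constant D^(p-1)(a).  So u_p has no terms of
    degrees 2, ..., p - 1; its coefficients of degrees 0, 1 and p are 0,
    D^(p-1)(a) and a^p, and it is evaluated at 1. *)
Theorem hochschild_formula f : D f = a * f ->
  iter p D f = (iter p.-1 D a + a ^+ p) * f.
Proof. by move=> /iter_der_log ->; rewrite u_p1. Qed.

End Formula.
End Hochschild.

(** * Finiteness of the logarithmic derivatives *)

Lemma noetherian_surj (T R : comNzRingType) (g : {rmorphism T -> R}) :
  (forall x, exists t, g t = x) -> noetherian T -> noetherian R.
Proof.
move=> gsurj noeT I subI; pose V : lmodType T := restriction g R^o.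
have ZE (t : T) (x : V) : t *: x = g t * (x : R) :> R by [].
have subV : submodule (I : set V).
  split=> [|t x y Ix Iy]; first by case: subI.
  by case: subI => _ /(_ (g t) x y Ix Iy).
have [|s sI Is] := @noetherian_submodule T V [:: (1 : R)] I noeT subV.
  move=> x _; have [t <-] := gsurj x.
  have -> : g t = t *: (1 : V) by rewrite ZE mulr1.
  by apply: (submoduleZ _ (lspan_submodule _)); apply: lspan_mem;
    rewrite mem_head.
exists s => // x Ix; apply: (Is x Ix (lspan (s : seq R^o))).
  split=> [|t y z sy sz]; first by case: (lspan_submodule (s : seq R^o)).
  by case: (lspan_submodule (s : seq R^o)) => _ /(_ (g t) y z sy sz).
by move=> y ys; apply: lspan_mem.
Qed.

Section DerivationModule.
Variables (k : closedFieldType) (p : nat) (kp : p \in [pchar k]).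
Variables (A : idomainAlgType k) (s : seq A).
Hypothesis s_gen : forall S : subalgClosed A,
  {subset s <= S} -> forall a : A, a \in S.

Lemma finite_type_noetherian : noetherian A.
Proof.
have [T [g [xs [noeT gs gk _ _]]]] :=
  noetherian_presentation (pchar_alg kp A) (in_alg A) s.
apply: (noetherian_surj (g := g)) noeT.
apply: (generation_ind s_gen (P := [set a | exists t, g t = a])) => //.
- by exists 1; rewrite rmorph1.
- move=> l u v [t <-] [t' <-]; have [r rE] := gk l; exists (r * t + t').
  by rewrite rmorphD rmorphM rE /= mulr_algl.
- by move=> u v [t <-] [t' <-]; exists (t * t'); rewrite rmorphM.
Qed.

Lemma der_comb_leibniz (a : A) (D E : derivation A) x y :
  (a * D (x * y) + E (x * y)) = (a * D x + E x) * y + x * (a * D y + E y).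
Proof. by rewrite !der_leibniz; ring. Qed.

Lemma der_comb_linear (a : A) (D E : derivation A) :
  linear (fun x => a * D x + E x).
Proof.
move=> l x y; rewrite !linearP mulrDr scalerDr -scalerAr.
by rewrite addrACA.
Qed.

Definition der_comb (a : A) (D E : derivation A) : derivation A :=
  @Derivation k A (linear_of (der_comb_linear a D E)) (der_comb_leibniz a D E).

Lemma der0_leibniz (x y : A) : 0 = 0 * y + x * 0 :> A.
Proof. by rewrite mul0r mulr0 addr0. Qed.

Lemma der0_linear : linear (fun _ : A => 0 : A).
Proof. by move=> l x y; rewrite scaler0 addr0. Qed.

Definition der_zero : derivation A :=
  @Derivation k A (linear_of der0_linear) der0_leibniz.

Variable B : subalgClosed A.
Local Notation F_B := (derivations_vanishing_on B).

(** A derivation is determined by its values on the generators of A, so F_B is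
    a submodule of a free module of finite rank over a noetherian ring. *)
Lemma vanishing_derivations_fg : exists r (Ds : 'I_r -> derivation A),
  (forall j, F_B (Ds j)) /\
  forall D, F_B D -> exists c : 'I_r -> A, forall a, D a = \sum_j c j * Ds j a.
Proof.
pose m := size s; pose row_of (D : derivation A) := \row_(i < m) D s`_i.
pose N : set 'rV[A]_m := [set v | exists2 D, F_B D & v = row_of D].
have subN : submodule N.
  split; first by exists der_zero => //; apply/rowP => i; rewrite !mxE.
  move=> a v w [D DB ->] [E EB ->]; exists (der_comb a D E).
    by move=> b bB; rewrite /= /linear_of_fun DB // EB // mulr0 addr0.
  by apply/rowP => i; rewrite !mxE.
have [|vs vsN Nvs] := noetherian_submodule
    (s := [seq delta_mx 0 i | i <- enum 'I_m]) finite_type_noetherian subN.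
  move=> v _; rewrite (row_sum_delta v).
  apply: (submodule_sum _ (lspan_submodule _)) => i _.
  apply: (submoduleZ _ (lspan_submodule _)); apply: lspan_mem.
  by apply: map_f; rewrite mem_enum.
have nthN (j : 'I_(size vs)) : exists D, F_B D /\ vs`_j = row_of D.
  by have [D DB vE] := vsN _ (mem_nth 0 (ltn_ord j)); exists D.
pose Ds j := projT1 (cid (nthN j)).
have DsP j : F_B (Ds j) /\ vs`_j = row_of (Ds j) by rewrite /Ds; case: cid.
exists (size vs), Ds; split=> [j|D DB]; first by case: (DsP j).
have [c cE] := lspan_coef (Nvs (row_of D) (ex_intro2 _ _ D DB erefl)).
exists (fun j => c j) => a.
apply: (generation_ind s_gen
  (P := [set a : A | D a = \sum_(j < size vs) c j * Ds j a])).
- by rewrite /= der1 big1 // => j _; rewrite der1 mulr0.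
- move=> l u v /= Du Dv; rewrite linearP Du Dv scaler_sumr -big_split /=.
  by apply: eq_bigr => j _; rewrite linearP mulrDr scalerAr.
- move=> u v /= Du Dv; rewrite der_leibniz Du Dv.
  rewrite mulr_suml mulr_sumr -big_split /=.
  by apply: eq_bigr => j _; rewrite der_leibniz; ring.
- move=> x xs /=; have xm : (index x s < m)%N by rewrite index_mem.
  have /rowP/(_ (Ordinal xm)) := cE; rewrite !mxE nth_index // => ->.
  rewrite summxE; apply: eq_bigr => j _; case: (DsP j) => _ ->.
  by rewrite !mxE nth_index.
Qed.

Section LogDerivatives.
Variables (r : nat) (Ds : 'I_r -> derivation A).
Hypothesis DsB : forall j, F_B (Ds j).
Hypothesis Ds_gen : forall D, F_B D ->
  exists c : 'I_r -> A, forall a, D a = \sum_j c j * Ds j a.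

Definition log_der (f : A) (a : 'I_r -> A) : Prop :=
  f != 0 /\ forall j, Ds j f = a j * f.

(** Hochschild's formula for D_j, where D_j^p, which vanishes on B too, is
    expanded over the generators D_l. *)
Lemma log_der_equation : exists c : 'I_r -> 'I_r -> A,
  forall f a, log_der f a -> forall j,
    a j ^+ p = \sum_l c j l * a l - iter p.-1 (Ds j) (a j).
Proof.
have p_gt0 : (0 < p)%N := prime_gt0 (pcharf_prime kp).
have cP j : exists c : 'I_r -> A,
    forall a, iter p (Ds j) a = \sum_l c l * Ds l a.
  apply: (Ds_gen (D := der_p kp (Ds j))) => b bB /=.
  rewrite /linear_of_fun -(prednK p_gt0) iterSr DsB //.
  by elim: p.-1 => //= n ->; rewrite linear0.
pose c j := projT1 (cid (cP j)).
have cE j a : iter p (Ds j) a = \sum_l c j l * Ds l a by rewrite /c; case: cid.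
exists c => f a [f0 fa] j; apply/(mulIf f0).
have := hochschild_formula kp (fa j).
rewrite cE (eq_bigr (fun l => c j l * a l * f)) => [E|l _];
  last by rewrite fa mulrA.
by rewrite mulrBl mulr_suml E mulrDl addrC addKr.
Qed.

(** If d is the least common bound for the degrees of the a j, the equation
    bounds the degree of (a j) ^+ p by d + C1, hence d <= (d + C1) / p + C + 1;
    as p >= 2, this bounds d independently of f. *)
Lemma log_der_degree : exists d0, forall f a, log_der f a ->
  forall j, deg_le s d0 (a j).
Proof.
have [c cE] := log_der_equation.
have [C Croot] := deg_le_pth_root kp s_gen.
have [c0 c0P] := deg_le_bound s_gen (fun q : 'I_r * 'I_r => c q.1 q.2).
have [c1 c1P] : exists c1, forall j d a, deg_le s d a ->
  deg_le s (d + c1)%N (Ds j a).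
  pose e j := projT1 (cid (deg_le_der s_gen (Ds j))).
  exists (\max_j e j)%N => j d a da.
  apply: (@deg_le_leq _ _ _ (d + e j)%N); first by rewrite leq_add2l leq_bigmax.
  by rewrite /e; case: cid => /= e' h; apply: h.
have iterP n j d a : deg_le s d a -> deg_le s (d + n * c1)%N (iter n (Ds j) a).
  move=> da; elim: n => [|n IHn]; first by rewrite addn0.
  by rewrite iterS mulSn [(c1 + _)%N]addnC addnA; apply: c1P.
pose C1 := (c0 + p.-1 * c1)%N.
exists (C1 + C1 + C + C + 2)%N => f a fa.
have ex_d : exists d, `[< forall j, deg_le s d (a j) >].
  by have [d dP] := deg_le_bound s_gen a; exists d; apply/asboolP.
case: (ex_minnP ex_d) => d /asboolP dP dmin j.
apply: (deg_le_leq _ (dP j)).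
have p1 := prime_gt1 (pcharf_prime kp).
pose e := ((d + C1) %/ p).+1.
have de : (d <= e + C)%N.
  apply/dmin/asboolP => i; apply: Croot; rewrite (cE _ _ fa).
  apply: (@deg_le_leq _ _ _ (d + C1)%N).
    rewrite /e mulnS [(p * _)%N]mulnC {1}(divn_eq (d + C1) p) addnC leq_add2r.
    by rewrite ltnW // ltn_pmod // ltnW.
  apply: (submoduleB (deg_le_submodule _ _)).
    apply: (submodule_sum _ (deg_le_submodule _ _)) => l _.
    apply: (@deg_le_leq _ _ _ (c0 + d)%N); last exact: deg_leM (c0P (i, l)) _.
    by rewrite addnC leq_add2l leq_addr.
  apply: deg_le_leq (iterP _ _ _ _ (dP i)).
  by rewrite leq_add2l leq_addl.
have : ((d + C1) %/ p <= (d + C1) %/ 2)%N by apply: leq_div2l.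
move: de; rewrite /e; move: ((d + C1) %/ p)%N => q de q2.
have : (q * 2 <= d + C1)%N
  by rewrite (leq_trans _ (leq_divM (d + C1) 2)) // leq_mul2r q2.
clear -de; lia.
Qed.

(** Induction on the support of mu, normalized to nu with nu i0 = 1.  The
    equation is k-linear on its right side, so applying it to the relation nu
    gives sum_i nu_i (a_i j) ^+ p = 0, and the p-th roots ka of the nu form a
    relation as well.  The difference ka - nu has smaller support since it
    vanishes at i0, hence is zero: nu is fixed by the Frobenius and is a
    relation with integer coefficients, against the hypothesis. *)
Lemma log_der_scalar_indep n (f : 'I_n -> A) (a : 'I_n -> 'I_r -> A) :
  (forall i, log_der (f i) (a i)) ->
  (forall m : 'I_n -> nat, (forall j, \sum_i a i j *+ m i = 0) ->
     forall i, (p %| m i)%N) ->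
  forall mu : 'I_n -> k, (forall j, \sum_i mu i *: a i j = 0) ->
    forall i, mu i = 0.
Proof.
move=> fa indep mu; have [c cE] := log_der_equation.
have p_gt0 : (0 < p)%N := prime_gt0 (pcharf_prime kp).
have [N] := ubnP #|[pred i | mu i != 0]|; elim: N mu => // N IHN mu suppN mu0 i0.
apply/eqP; apply: contraT => mui0.
pose nu i := mu i / mu i0.
have nu0 j : \sum_i nu i *: a i j = 0.
  rewrite (eq_bigr (fun i => (mu i0)^-1 *: (mu i *: a i j))).
    by rewrite -scaler_sumr mu0 scaler0.
  by move=> i _; rewrite scalerA mulrC.
have nup j : \sum_i nu i *: a i j ^+ p = 0.
  have Psi0 : \sum_l c j l * (\sum_i nu i *: a i l)
      - iter p.-1 (Ds j) (\sum_i nu i *: a i j) = 0.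
    rewrite big1 => [|l _]; last by rewrite nu0 mulr0.
    rewrite nu0 sub0r; apply/eqP; rewrite oppr_eq0; apply/eqP.
    by elim: p.-1 => //= n' ->; rewrite linear0.
  pose Ej := linear_of (iter_der_linear (Ds j) p.-1).
  rewrite -[RHS]Psi0 -[iter p.-1 (Ds j)]/(Ej : A -> A).
  rewrite linear_sum.
  under [X in _ = X - _]eq_bigr => l _ do rewrite mulr_sumr.
  rewrite exchange_big -sumrB; apply: eq_bigr => i _.
  rewrite (cE _ _ (fa i)) scalerBr [Ej _]linearZ scaler_sumr; congr (_ - _).
  by apply: eq_bigr => l _; rewrite scalerAr.
pose ka i := projT1 (cid (ex_pth_root (nu i) p_gt0)).
have kaE i : ka i ^+ p = nu i by rewrite /ka; case: cid.
have ka0 j : \sum_i ka i *: a i j = 0.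
  apply: (pth_inj (pchar_alg kp A)); rewrite (sum_pth _ _ (pchar_alg kp A)).
  rewrite expr0n gtn_eqF // -[RHS](nup j).
  by apply: eq_bigr => i _; rewrite exprZn kaE.
have nui0 : nu i0 = 1 by rewrite /nu divff.
have ka_nu i : ka i - nu i = 0.
  apply: (IHN (fun i => ka i - nu i)) => [|j]; last first.
    under eq_bigr => l _ do rewrite scalerBl.
    by rewrite sumrB ka0 nu0 subrr.
  rewrite -ltnS; apply: leq_trans suppN; rewrite ltnS; apply: proper_card.
  apply/properP; split.
    apply/fintype.subsetP => l; rewrite !inE; apply: contraNneq => mul0.
    have nul : nu l = 0 by rewrite /nu mul0 mul0r.
    rewrite nul subr0; have := kaE l; rewrite nul => /eqP.
    by rewrite expf_eq0 p_gt0.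
  exists i0; rewrite !inE //= negbK subr_eq0 nui0; apply/eqP.
  by apply: (pth_inj kp); rewrite /= kaE nui0 expr1n.
have nat_nu i : exists m : nat, nu i = m%:R.
  apply: (Frobenius_fixed kp); rewrite -{2}kaE; congr (_ ^+ _).
  by apply/eqP; rewrite eq_sym -subr_eq0 ka_nu.
pose m i := projT1 (cid (nat_nu i)).
have mE i : nu i = (m i)%:R by rewrite /m; case: cid.
have := indep m _ i0; rewrite (dvdn_pcharf kp) -mE nui0 oner_eq0; apply.
move=> j; rewrite -[RHS](nu0 j); apply: eq_bigr => i _.
by rewrite mE scaler_nat.
Qed.

End LogDerivatives.

(** The vectors of logarithmic derivatives along the generators of F_B have
    entries in the k-span of the words of degree d0.  By log_der_scalar_indep
    they are independent over k, so there are at most as many of them as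
    coordinates. *)
Theorem algebraic_solutions_rank_bounded : exists N, forall n (f : 'I_n -> A),
  (forall i, f i != 0) ->
  (forall i D, F_B D -> exists a, D (f i) = a * f i) ->
  (forall m : 'I_n -> nat, (forall D, F_B D -> D (\prod_i f i ^+ m i) = 0) ->
     forall i, (p %| m i)%N) ->
  (n <= N)%N.
Proof.
have [r [Ds [DsB Ds_gen]]] := vanishing_derivations_fg.
have [d0 d0P] := log_der_degree DsB Ds_gen.
pose w := size (words s d0); pose J : finType := ('I_r * 'I_w)%type.
exists #|J| => n f f0 fsol indep; rewrite leqNgt; apply/negP => Jn.
pose a i j := projT1 (cid (fsol i (Ds j) (DsB j))).
have aE i : log_der Ds (f i) (a i).
  by split=> // j; rewrite /a; case: cid.
have cP i j : exists c : nat -> k, a i j = \sum_(l < w) c l *: (words s d0)`_l.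
  exact: lspan_coef (d0P _ _ (aE i) j).
pose c i j := projT1 (cid (cP i j)).
have cE i j : a i j = \sum_(l < w) c i j l *: (words s d0)`_l.
  by rewrite /c; case: cid.
pose M : 'M[k]_(n, #|J|) :=
  \matrix_(i, q) let jl : J := enum_val q in c i jl.1 jl.2.
(* There are more vectors than coordinates, so the rows of M are dependent. *)
have kerM : kermx M != 0.
  rewrite kermx_eq0 /row_free; apply: contraTneq Jn => <-.
  by rewrite -leqNgt rank_leq_col.
have /rowV0Pn[v /sub_kermxP vM v0] := kerM.
have indepa (m : 'I_n -> nat) : (forall j, \sum_i a i j *+ m i = 0) ->
    forall i, (p %| m i)%N.
  move=> m0; apply: indep => D DB; have [e eE] := Ds_gen D DB.
  have log_prod j : Ds j (\prod_i f i ^+ m i) = 0.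
    have : Ds j (\prod_i f i ^+ m i) = (\sum_i a i j *+ m i) * \prod_i f i ^+ m i.
      apply: (big_ind2 (fun x y => Ds j y = x * y)) => [|x1 x2 y1 y2 h1 h2|i _].
      - by rewrite der1 mul0r.
      - by rewrite der_leibniz h1 h2; ring.
      elim: (m i) => [|q IHq]; first by rewrite der1 mul0r.
      by rewrite exprS der_leibniz IHq (aE i).2 mulrS; ring.
    by rewrite m0 mul0r.
  by rewrite eE big1 // => j _; rewrite log_prod mulr0.
have mu0 := log_der_scalar_indep DsB Ds_gen aE indepa (mu := v 0).
move/eqP: v0; apply; apply/rowP => i; rewrite mxE; apply: mu0 => j.
under eq_bigr => l _ do rewrite cE scaler_sumr.
rewrite exchange_big big1 //= => l _.
under eq_bigr => q _ do rewrite scalerA.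
rewrite -scaler_suml; have /rowP/(_ (enum_rank (j, l))) := vM.
rewrite !mxE => vM0; suff -> : \sum_q v 0 q * c q j l = 0 by rewrite scale0r.
by rewrite -[RHS]vM0; apply: eq_bigr => q _; rewrite mxE enum_rankK.
Qed.

End DerivationModule.

(** * Ideals whose extension to A is principal *)

Section PicardClasses.
Variables (k : fieldType) (p : nat) (kp : p \in [pchar k]).
Variables (A : idomainAlgType k) (B : subalgClosed A).
Local Notation SB := (subalg B).
Local Notation iota := (subalg_incl B).

Arguments subalg_incl : simpl never.

Lemma iota_inj : injective iota.
Proof. exact: val_inj. Qed.

Lemma iotaZ (a : SB) (b : SB^o) : iota (a *: b) = iota a * iota (b : SB).
Proof. exact: rmorphM. Qed.

(** The class x is represented by an ideal of B, the image of phi, whose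
    extension to A is generated by f. *)
Definition generates_pullback (x : pic SB) (f : A) : Prop :=
  exists (M : lmodType SB) (iM : invertible M) (phi : {linear M -> SB^o}),
    [/\ x = pic_of iM, f != 0,
        forall m, exists a, iota (phi m : SB) = f * a
      & exists s : seq (M * A),
          f = \sum_(q <- s) iota (phi q.1 : SB) * q.2].

Lemma generates_pullback0 : generates_pullback 0 1.
Proof.
exists SB^o, (invertible1 SB), (@idfun SB^o); split=> //.
- exact: oner_neq0.
- by move=> m; exists (iota (m : SB)); rewrite mul1r.
- by exists [:: (1 : SB^o, 1)]; rewrite big_seq1 /= mulr1.
Qed.

Lemma generates_pullbackD x y f g :
  generates_pullback x f -> generates_pullback y g ->
  generates_pullback (x + y) (f * g).
Proof.
move=> [M [iM [phi [-> f0 fM [s sE]]]]] [N [iN [psi [-> g0 gN [t tE]]]]].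
have b : bilin (fun (m : M) (n : N) => (phi m : SB) * (psi n : SB) : SB^o).
  split=> [m m' n|m n n'|a m n|a m n].
  - by rewrite linearD; exact: mulrDl.
  - by rewrite linearD; exact: mulrDr.
  - by rewrite [phi _]linearZ; exact: (esym (@mulrA SB a (phi m) (psi n))).
  - by rewrite [psi _]linearZ; exact: (@mulrCA SB (phi m) a (psi n)).
exists (tens M N), (invertible_tens iM iN), (tens_lift b); split.
- exact: pic_addE.
- exact: mulf_neq0.
- elim/tens_ind=> [m n|z z' [a aE] [a' a'E]].
    have [a aE] := fM m; have [a' a'E] := gN n; exists (a * a').
    by rewrite tens_liftE rmorphM aE a'E mulrACA.
  by exists (a + a'); rewrite linearD rmorphD aE a'E mulrDr.
- exists [seq (pure q.1 r.1, q.2 * r.2) | q <- s, r <- t].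
  rewrite {1}sE {1}tE mulr_suml big_allpairs_dep.
  apply: eq_bigr => q _; rewrite mulr_sumr; apply: eq_bigr => r _.
  by rewrite [in RHS]tens_liftE rmorphM mulrACA.
Qed.

Lemma generates_pullbackX x f n :
  generates_pullback x f -> generates_pullback (x *+ n) (f ^+ n).
Proof.
move=> xf; elim: n => [|n IHn]; first exact: generates_pullback0.
by rewrite mulrS exprS; apply: generates_pullbackD.
Qed.

Lemma generates_pullback_sum n (x : 'I_n -> pic SB) (f : 'I_n -> A)
    (c : 'I_n -> nat) :
  (forall i, generates_pullback (x i) (f i)) ->
  generates_pullback (\sum_(i < n) x i *+ c i) (\prod_(i < n) f i ^+ c i).
Proof.
move=> xf.
apply: (big_ind2 (fun y g => generates_pullback y g)) => [|y g z h|i _].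
- exact: generates_pullback0.
- exact: generates_pullbackD.
- exact: generates_pullbackX.
Qed.

Lemma generates_pullback_neq0 x f : generates_pullback x f -> f != 0.
Proof. by case=> M [iM [phi []]]. Qed.

(** A nonzero functional phi on M induces an A-linear map from M (x) A, which
    is free of rank one, onto the extension of phi(M); f is the image of a
    generator. *)
Lemma generates_pullback_ker x : pic_pullback (subalg_incl B) x = 0 ->
  exists f, generates_pullback x f.
Proof.
move=> x0; pose M := pic_repr x; pose iM : invertible M := pic_repr_inv x.
have xE : x = pic_of iM by rewrite /iM pic_reprK.
have [g [h gK hK]] : lmod_iso (A^o) (base_change (subalg_incl B) M).
  apply: lmod_iso_sym; apply/(pic_ofP (invertible_bc _ iM) (invertible1 A)).
  by rewrite -pic_pullbackE -xE x0.
have [_ _ _ [phi [y y0]]] := invertible_rank1_projective iM.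
have l : linear (fun m => iota (phi m : SB)
                   : restriction (subalg_incl B) A^o).
  by move=> a m m'; rewrite linearP rmorphD.
pose Phi := bc_lift (linear_of l).
have PhiE m a : Phi (bpure _ m a) = a * iota (phi m : SB).
  by rewrite bpureZ linearZ bc_liftE.
pose f : A := Phi (g 1).
have fP w : exists a, Phi w = f * a.
  exists (h w); rewrite /f mulrC -[w in LHS]hK.
  rewrite -[h w * _]/(h w *: (Phi (g 1))) -linearZ -linearZ.
  by congr (Phi (g _)); apply/esym/mulr1.
exists f, M, iM, phi; split=> //.
- apply: contra_neq y0 => f0; apply: val_inj => /=.
  have [a] := fP (bpure _ y 1).
  by rewrite PhiE mul1r f0 mul0r.
- by move=> m; have [a aE] := fP (bpure _ m 1); exists a; rewrite -aE PhiE mul1r.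
- rewrite /f; elim/bc_tens_ind: (g 1) => [m a|w w' [s sE] [s' s'E]].
    by exists [:: (m, a)]; rewrite big_seq1 PhiE mulrC.
  by exists (s ++ s'); rewrite big_cat /= linearD sE s'E.
Qed.

(** D kills the coefficients phi(m) in f = sum phi(m) c, and each phi(m) is a
    multiple of f. *)
Lemma generates_pullback_der x f (D : derivation A) :
  generates_pullback x f -> derivations_vanishing_on B D ->
  exists a, D f = a * f.
Proof.
move=> [M [iM [phi [_ _ fM [s sE]]]]] DB.
pose d m := projT1 (cid (fM m)).
have dE m : iota (phi m : SB) = f * d m by rewrite /d; case: cid.
exists (\sum_(q <- s) d q.1 * D q.2).
rewrite {1}sE linear_sum mulr_suml; apply: eq_bigr => q _.
rewrite der_leibniz DB ?mul0r ?add0r; last exact: subalg_valP.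
by rewrite dE -mulrA mulrC.
Qed.

Hypothesis B_normal : normal_domain SB.
Hypothesis ApB : forall a : A, a ^+ p \in B.

(** The fraction b / c of the fraction field of B has the p-th power a ^+ p of
    B, so it is integral over B. *)
Lemma normal_quotient (a b c : A) :
  b \in B -> c \in B -> c != 0 -> b = a * c -> a \in B.
Proof.
move=> bB cB c0 bE.
pose b' : SB := Subalg bB; pose c' : SB := Subalg cB.
pose e' : SB := Subalg (ApB a).
have c'0 : c' != 0 by apply: contra_neq c0 => /(congr1 val).
have tc0 : tofrac c' != 0 by rewrite tofrac_eq0.
have [|d dE] := B_normal (x := tofrac b' / tofrac c').
  exists ('X^p - e'%:P); first
    by rewrite monicXnsubC // (prime_gt0 (pcharf_prime kp)).
  rewrite rmorphB /= map_polyXn map_polyC /= rootE !hornerE.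
  rewrite expr_div_n subr_eq0 -!rmorphXn; apply/eqP.
  apply: (canLR (mulfK _)); first by rewrite tofrac_eq0 expf_neq0.
  rewrite -rmorphM; congr tofrac; apply: val_inj.
  by rewrite rmorphM !rmorphXn /= bE exprMn.
suff -> : a = iota d by apply: subalg_valP.
apply: (mulIf c0); rewrite -bE.
have : tofrac b' = tofrac (d * c') 
  by rewrite [RHS]rmorphM;
    exact: etrans (esym (divfK tc0 _)) (congr1 ( *%R^~ _) dE).
by move/eqP; rewrite tofrac_eq => /eqP /(congr1 val); rewrite rmorphM.
Qed.

(** Dividing phi by f, which is possible inside B by normal_quotient, gives a
    functional psi on M whose values generate the unit ideal of A.  The p-th
    power of a relation 1 = sum psi(m) c has coefficients c ^+ p in B, so psi
    takes the value 1. *)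
Lemma generates_pullback_eq0 x f : generates_pullback x f -> f \in B -> x = 0.
Proof.
move=> [M [iM [phi [-> f0 fM [s sE]]]]] fB.
have fMB m : exists b : SB, iota (phi m : SB) = f * iota b.
  have [a aE] := fM m; have aB : a \in B.
    by apply: (normal_quotient (subalg_valP (phi m : SB)) fB f0); rewrite mulrC.
  by exists (Subalg aB).
pose psi m : SB^o := projT1 (cid (fMB m)).
have psiE m : iota (phi m : SB) = f * iota (psi m : SB).
  by rewrite /psi; case: cid.
have l : linear psi.
  move=> a m n; apply: iota_inj; apply: (mulfI f0).
  rewrite -psiE linearP !rmorphD mulrDr -psiE; congr (_ + _).
  by rewrite !iotaZ psiE mulrCA.
have sum1 : 1 = \sum_(q <- s) iota (psi q.1 : SB) * q.2.
  apply: (mulfI f0); rewrite mulr1 {1}sE mulr_sumr; apply: eq_bigr => q _.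
  by rewrite psiE mulrA.
pose y := \sum_(q <- s) ((psi q.1 : SB) ^+ p.-1 * Subalg (ApB q.2)) *: q.1.
have y1 : linear_of l y = 1.
  apply: iota_inj; rewrite linear_sum rmorph_sum rmorph1 -(expr1n A p) sum1.
  rewrite (sum_pth _ _ (pchar_alg kp A)); apply: eq_bigr => q _.
  rewrite linearZ iotaZ rmorphM rmorphXn mulrAC -exprSr exprMn.
  by rewrite prednK // (prime_gt0 (pcharf_prime kp)).
apply/pic_ofP; apply: (@bij_functional_free _ _ (linear_of l) y) => //.
by rewrite y1 unitr1.
Qed.

Lemma pic_ker_pchar (x : pic_ker (subalg_incl B)) : x *+ p = 0.
Proof.
case: x => x x0; apply: val_inj; rewrite raddfMn raddf0 /=.
have [f xf] := generates_pullback_ker (eqP x0).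
exact: (generates_pullback_eq0 (generates_pullbackX p xf) (ApB f)).
Qed.

End PicardClasses.

(** * Derivations of purely inseparable extensions *)

Section PurelyInseparable.
Variables (K : fieldType) (p : nat) (Kp : p \in [pchar K]).
Let p_gt0 : (0 < p)%N := prime_gt0 (pcharf_prime Kp).

Section Euclid.
Variable S : subringClosed K.

Lemma polyOver_euclid (Q : {poly K}) : Q \is monic -> Q \is a polyOver S ->
  forall P, P \is a polyOver S -> exists U R,
    [/\ U \is a polyOver S, R \is a polyOver S, P = U * Q + R
      & (size R < size Q)%N].
Proof.
move=> monQ QS P; have [n] := ubnP (size P); elim: n P => // n IHn P sPn PS.
have [sPQ | sQP] := ltnP (size P) (size Q).
  by exists 0, P; rewrite rpred0 mul0r add0r.
have Q0 : (0 < size Q)%N by rewrite size_poly_gt0 monic_neq0.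
have P0 : (0 < size P)%N by apply: leq_trans sQP.
pose e := (size P - size Q)%N.
pose T := lead_coef P *: 'X^e.
have TS : T \is a polyOver S.
  by rewrite polyOverZ ?polyOverXn // lead_coefE; apply: (polyOverP PS).
have [||U [R [US RS PE sR]]] := IHn (P - T * Q).
- rewrite -ltnS; apply: leq_trans sPn; rewrite ltnS -(prednK P0) ltnS.
  apply/leq_sizeP => j; rewrite leq_eqVlt => /orP[/eqP <-|jP].
    rewrite coefB -scalerAl coefZ coefXnM ifF; last first.
      apply/negbTE; rewrite -leqNgt /e; lia.
    have -> : ((size P).-1 - e = (size Q).-1)%N by rewrite /e; lia.
    by rewrite -!lead_coefE (monicP monQ) mulr1 subrr.
  have {}jP : (size P <= j)%N by rewrite -(prednK P0).
  have ej : (e <= j)%N := leq_trans (leq_subr _ _) jP.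
  have Qj : (size Q <= j - e)%N by rewrite -(subKn sQP) leq_sub2r.
  by rewrite coefB -scalerAl coefZ coefXnM ltnNge ej !nth_default // mulr0 subrr.
- by rewrite rpredB // rpredM.
by exists (T + U), R; rewrite rpredD // mulrDl -addrA -PE addrCA subrr addr0.
Qed.

Definition adjoin (y : K) : set K :=
  [set z | exists2 P, P \is a polyOver S & P.[y] = z].

Lemma adjoin_subring y : exists S' : subringClosed K,
  forall x, x \in S' <-> adjoin y x.
Proof.
apply: subring_of_set.
- by exists 1; rewrite ?rpred1 // hornerC.
- by move=> _ _ [P PS <-] [Q QS <-]; exists (P - Q); rewrite ?rpredB // !hornerE.
- by move=> _ _ [P PS <-] [Q QS <-]; exists (P * Q); rewrite ?rpredM // !hornerE.
Qed.

Lemma adjoin_sub y x : x \in S -> adjoin y x.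
Proof. by move=> xS; exists x%:P; rewrite ?polyOverC // hornerC. Qed.

Lemma adjoin_gen y : adjoin y y.
Proof. by exists 'X; rewrite ?polyOverX // hornerX. Qed.

Hypothesis pthS : forall x, x ^+ p \in S.

Lemma pth_subring_inv x : x \in S -> x^-1 \in S.
Proof.
move=> xS; have [->|x0] := eqVneq x 0; first by rewrite invr0 rpred0.
have -> : x^-1 = x ^+ p.-1 * x^-1 ^+ p.
  rewrite -[in x^-1 ^+ p](prednK p_gt0) exprS mulrCA -exprMn mulfV //.
  by rewrite expr1n mulr1.
by apply: rpredM (pthS _); apply: rpredX.
Qed.

Lemma Xp_sub (y : K) : 'X^p - (y ^+ p)%:P = ('X - y%:P) ^+ p.
Proof.
have Xp : p \in [pchar {poly K}] by exact: (rmorph_pchar (@polyC K)).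
have := rmorphB (pFrobenius_aut Xp) 'X y%:P; rewrite /= !pFrobenius_autE => ->.
by rewrite polyC_exp.
Qed.

(** A monic Q of least degree over S with root y divides X^p - y^p = (X - y)^p,
    so that Q = (X - y)^j.  If j < p, the second coefficient - j y of Q
    gives y in S. *)
Lemma low_degree_eq0 y P : y \notin S -> P \is a polyOver S -> P.[y] = 0 ->
  (size P <= p)%N -> P = 0.
Proof.
move=> yS PS Py sP; apply/eqP; apply: contraT => P0.
pose bad n := `[< exists P, [/\ P \is a polyOver S, P.[y] = 0, P != 0
                              & size P = n] >].
have ex_bad : exists n, bad n by exists (size P); apply/asboolP; exists P.
case: (ex_minnP ex_bad) => n /asboolP[Q1 [Q1S Q1y Q10 sQ1]] nmin.
have np : (n <= p)%N by apply: leq_trans sP; apply/nmin/asboolP; exists P.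
pose Q := (lead_coef Q1)^-1 *: Q1.
have lQ0 : lead_coef Q1 != 0 by rewrite lead_coef_eq0.
have sQ : size Q = n by rewrite size_scale ?invr_eq0.
have monQ : Q \is monic by rewrite monicE lead_coefZ mulVf.
have QS : Q \is a polyOver S.
  rewrite polyOverZ // pth_subring_inv // lead_coefE; exact: (polyOverP Q1S).
have Qy : Q.[y] = 0 by rewrite hornerZ Q1y mulr0.
clearbody Q.
have XpS : 'X^p - (y ^+ p)%:P \is a polyOver S.
  by rewrite rpredB ?polyOverXn ?polyOverC.
have [U [R [US RS XE sR]]] := polyOver_euclid monQ QS XpS.
have R0 : R = 0.
  apply/eqP; apply: contraT => Rn0.
  suff : (n <= size R)%N by rewrite leqNgt -sQ sR.
  apply/nmin/asboolP; exists R; split=> //.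
  have := congr1 (horner^~ y) XE; rewrite !hornerE Qy mulr0 add0r subrr.
  exact/esym.
have : Q %| ('X - y%:P) ^+ p by rewrite -Xp_sub XE R0 addr0 dvdp_mull.
case/dvdp_exp_XsubCP => j _;
  rewrite eqp_monic ?monic_exp ?monicXsubC // => /eqP QE.
have sj : n = j.+1 by rewrite -sQ QE size_exp_XsubC.
have j0 : (0 < j)%N.
  case: j QE {sj} => // QE; move: Qy; rewrite QE expr0 hornerC => /eqP.
  by rewrite oner_eq0.
have jyS : y *+ j \in S.
  have QE' : Q = \prod_(z <- nseq j y) ('X - z%:P)
    by rewrite big_nseq iter_mulr_1.
  rewrite -rpredN.
  have -> : - (y *+ j) = Q`_j.-1.
    have := @coefPn_prod_XsubC K (nseq j y).
    by rewrite -QE' size_nseq big_nseq iter_addr_0 => ->; rewrite // -lt0n.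
  exact: (polyOverP QS).
have jn0 : j%:R != 0 :> K.
  rewrite -(dvdn_pcharf Kp); apply/negP => /dvdn_leq -/(_ j0).
  by rewrite leqNgt -sj np.
case/negP: yS; rewrite -[y](mulfK jn0) mulr_natr.
by rewrite rpredM // pth_subring_inv // rpred_nat.
Qed.

(** P is a multiple of X^p - y^p, whose derivative is zero. *)
Lemma root_deriv_eq0 y P : y \notin S -> P \is a polyOver S -> P.[y] = 0 ->
  P^`().[y] = 0.
Proof.
move=> yS PS Py.
have monX : 'X^p - (y ^+ p)%:P \is monic by rewrite monicXnsubC.
have XpS : 'X^p - (y ^+ p)%:P \is a polyOver S.
  by rewrite rpredB ?polyOverXn ?polyOverC.
have [U [R [US RS PE sR]]] := polyOver_euclid monX XpS PS.
have R0 : R = 0.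
  apply: (low_degree_eq0 yS RS).
    by have := congr1 (horner^~ y) PE; rewrite Py !hornerE subrr mulr0 add0r.
  by rewrite size_XnsubC // ltnS in sR.
rewrite PE R0 addr0 derivM derivB derivXn derivC subr0 !hornerE subrr mulr0 add0r.
by rewrite hornerMn -mulr_natr (pcharf0 Kp) !mulr0.
Qed.

End Euclid.

(** Let L be maximal among the subrings of K that contain L0 and not f.  Then
    K = L[f]: if y were not in L[f], then f = R(y) for some R over L of degree
    less than p by maximality, and R - f, a polynomial over L[f] of degree less
    than p with root y, would be zero, so that f would be in L.  Now the
    derivation sends P(f) to P'(f), for P with coefficients in L. *)
Lemma ex_derivation_neq0 (L0 : subringClosed K) (f : K) :
  (forall x, x ^+ p \in L0) -> f \notin L0 ->
  exists D : K -> K, [/\ forall x y, D (x + y) = D x + D y,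
    forall x y, D (x * y) = D x * y + x * D y,
    forall x, x \in L0 -> D x = 0 & D f != 0].
Proof.
move=> pth0 fL0.
(* The empty set is admitted since the union of the empty chain must be; it is
   not maximal. *)
pose good (X : set K) := [/\ [set` L0] `<=` X, ~ X f,
  forall x y, X x -> X y -> X (x - y) & forall x y, X x -> X y -> X (x * y)].
have [X [XX Xmax]] : exists X, (X = set0 \/ good X) /\
    forall Y, X `<` Y -> ~ (Y = set0 \/ good Y).
  apply: Zorn_bigcup => F FP Ftot.
  have [[X FX gX] | nF] := pselect (exists2 X, F X & good X); last first.
    left; apply/seteqP; split=> // x [X FX Xx].
    have [X0 | gX] := FP _ FX; first by rewrite X0 in Xx.
    by case: nF; exists X.
  right; have two Y Z x y : F Y -> F Z -> Y x -> Z y ->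
      exists W, [/\ F W, good W, W x & W y].
    move=> FY FZ Yx Zy.
    have [YZ | ZY] := Ftot _ _ FY FZ.
      have [Z0 | gZ] := FP _ FZ; first by rewrite Z0 in Zy.
      by exists Z; split=> //; apply: YZ.
    have [Y0 | gY] := FP _ FY; first by rewrite Y0 in Yx.
    by exists Y; split=> //; apply: ZY.
  split.
  - by case: gX => L0X _ _ _ x /L0X Xx; exists X.
  - move=> [Y FY Yf]; have [Y0 | [_ nYf _ _]] := FP _ FY; last exact: nYf.
    by rewrite Y0 in Yf.
  - move=> x y [Y FY Yx] [Z FZ Zy].
    have [W [FW [_ _ WB _] Wx Wy]] := two _ _ _ _ FY FZ Yx Zy.
    by exists W => //; apply: WB.
  - move=> x y [Y FY Yx] [Z FZ Zy].
    have [W [FW [_ _ _ WM] Wx Wy]] := two _ _ _ _ FY FZ Yx Zy.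
    by exists W => //; apply: WM.
have goodL0 : good [set` L0].
  split=> //=; first by apply/negP.
    by move=> x y; apply: rpredB.
  by move=> x y; apply: rpredM.
have {XX} [L0X nXf XB XM] : good X.
  case: XX => // X0; case: (Xmax [set` L0]); last by right.
  rewrite X0; split=> // h; have := h 1; rewrite /= rpred1; exact.
have [L LX] := subring_of_set (L0X _ (rpred1 L0)) XB XM.
have {}fL : f \notin L by apply/negP => /LX.
have pthL x : x ^+ p \in L by apply/LX/L0X/pth0.
have [Lf LfE] := adjoin_subring L f.
have pthLf x : x ^+ p \in Lf by apply/LfE/adjoin_sub/pthL.
have gen y : adjoin L f y.
  apply: contrapT => nyLf.
  have yLf : y \notin Lf by apply/negP => /LfE.
  have nXy : ~ X y by move=> /LX yL; apply/nyLf/adjoin_sub.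
  have [Ly LyE] := adjoin_subring L y.
  have [P PL Pf] : adjoin L y f.
    apply: contrapT => nf; apply: (Xmax [set` Ly]).
      split=> [x Xx|h]; first by apply/LyE/adjoin_sub/LX.
      by apply/nXy/h/LyE/adjoin_gen.
    right; split=> [x Lx||u v|u v] /=; last 2 first.
    - by apply: rpredB.
    - by apply: rpredM.
    - by apply/LyE/adjoin_sub/LX/L0X.
    - by move/LyE.
  have monX : 'X^p - (y ^+ p)%:P \is monic by rewrite monicXnsubC.
  have XpL : 'X^p - (y ^+ p)%:P \is a polyOver L.
    by rewrite rpredB ?polyOverXn ?polyOverC.
  have [U [R [UL RL PE sR]]] := polyOver_euclid monX XpL PL.
  have Rf : R.[y] = f.
    by rewrite -Pf PE !hornerE subrr mulr0 add0r.
  have /eqP : R - f%:P = 0.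
    apply: (low_degree_eq0 pthLf yLf).
    - rewrite rpredB ?polyOverC //; last exact/LfE/adjoin_gen.
      by apply/polyOverP => i; apply/LfE/adjoin_sub/(polyOverP RL).
    - by rewrite !hornerE Rf subrr.
    - rewrite (leq_trans (size_polyD _ _)) // geq_max size_polyN.
      rewrite size_XnsubC // ltnS in sR; rewrite sR.
      exact: leq_trans (size_polyC_leq1 _) _.
  rewrite subr_eq0 => /eqP RE; case/negP: fL.
  by have := polyOverP RL 0%N; rewrite RE coefC.
pose P y := projT1 (cid2 (gen y)).
have PL y : P y \is a polyOver L by rewrite /P; case: cid2.
have Pf y : (P y).[f] = y by rewrite /P; case: cid2.
have DE Q : Q \is a polyOver L -> (P Q.[f])^`().[f] = Q^`().[f].
  move=> QL; apply/eqP; rewrite -subr_eq0 -hornerN -hornerD -derivN -derivD.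
  apply/eqP/(root_deriv_eq0 pthL fL); first by rewrite rpredB.
  by rewrite !hornerE Pf subrr.
exists (fun y => (P y)^`().[f]); split.
- move=> x y; rewrite -{1}(Pf x) -{1}(Pf y) -hornerD DE ?rpredD //.
  by rewrite derivD hornerD.
- move=> x y; rewrite -{1}(Pf x) -{1}(Pf y) -hornerM DE ?rpredM //.
  by rewrite derivM !hornerE !Pf.
- move=> x xL0; rewrite -{1}[x](hornerC x f) DE ?derivC ?hornerC //.
  by rewrite polyOverC; apply/LX/L0X.
- rewrite -{1}[f](hornerX f) DE ?polyOverX // derivX hornerC; exact: oner_neq0.
Qed.

End PurelyInseparable.

Section FirstIntegrals.
Variables (k : fieldType) (p : nat) (kp : p \in [pchar k]).
Variables (A : idomainAlgType k) (B : subalgClosed A).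
Hypothesis A_ft : finite_type_alg A.
Hypothesis B_normal : normal_domain (subalg B).
Hypothesis ApB : forall a : A, a ^+ p \in B.
Local Notation K := {fraction A}.

(** The fraction field of B inside that of A. *)
Definition frac_sub : set K :=
  [set x | exists b c : A, [/\ b \in B, c \in B, c != 0 &
    x = tofrac b / tofrac c]].

(** Take a derivation of the fraction field of A that kills the fraction field
    of B and not f, which exists because f lies outside the latter field by
    normality of B; multiply it by a common denominator of its values on the
    generators of A. *)
Lemma ex_vanishing_derivation (f : A) : f \notin B ->
  exists2 D : derivation A, derivations_vanishing_on B D & D f != 0.
Proof.
move=> fB; have Ap := pchar_alg kp A.
have Kp : p \in [pchar K] by exact: (rmorph_pchar (@tofrac A)).
have t0 (c : A) : c != 0 -> tofrac c != 0 by rewrite tofrac_eq0.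
have [B1 B_sub B_mul] := GRing.subalg_closedBM (GRing.subalgClosedP B).
have [L LE] : exists L : subringClosed K, forall x, x \in L <-> frac_sub x.
  apply: subring_of_set.
  - by exists 1, 1; rewrite B1 oner_neq0 tofrac1 divr1.
  - move=> _ _ [b [c [bB cB c0 ->]]] [b' [c' [b'B c'B c'0 ->]]].
    exists (b * c' - b' * c), (c * c').
    rewrite mulf_neq0 //; split; rewrite ?B_sub ?B_mul //.
    by rewrite -mulNr addf_div ?t0 // tofracB !tofracM mulNr.
  - move=> _ _ [b [c [bB cB c0 ->]]] [b' [c' [b'B c'B c'0 ->]]].
    exists (b * b'), (c * c').
    by rewrite !B_mul // mulf_neq0 // mulf_div !tofracM.
have pthL x : x ^+ p \in L.
  apply/LE; have [d0 ->] := frac_repr x.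
  exists (\n_(repr x) ^+ p), (\d_(repr x) ^+ p).
  by rewrite !ApB expf_neq0 // expr_div_n !tofracXn.
have fL : tofrac f \notin L.
  apply/negP => /LE[b [c [bB cB c0 fE]]]; case/negP: fB.
  apply: (normal_quotient kp B_normal ApB bB cB c0).
  by apply/eqP; rewrite -tofrac_eq tofracM fE divfK ?t0.
have [D [DD DM DL Df]] := ex_derivation_neq0 Kp pthL fL.
have DB b : b \in B -> D (tofrac b) = 0.
  by move=> bB; apply/DL/LE; exists b, 1; rewrite B1 oner_neq0 tofrac1 divr1.
have DZ l (u : A) : D (tofrac (l *: u)) = tofrac l%:A * D (tofrac u).
  have -> : l *: u = l%:A * u by rewrite mulr_algl.
  rewrite tofracM DM DB ?mul0r ?add0r //.
  have [_ B_lin _] := GRing.subalgClosedP B.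
  by rewrite -[l%:A]addr0 B_lin // -(subrr 1) B_sub.
have [s s_gen] := A_ft.
have [e e0 es] : exists2 e : A, e != 0 &
    forall x, x \in s -> exists a, tofrac e * D (tofrac x) = tofrac a.
  elim: s {s_gen} => [|x s [e e0 es]]; first by exists 1; rewrite ?oner_neq0.
  have [d0 DxE] := frac_repr (D (tofrac x)).
  set d := \d_(_) in d0 DxE; set n := \n_(_) in DxE.
  exists (d * e); first by rewrite mulf_neq0.
  move=> y; rewrite inE => /orP[/eqP ->|/es[a aE]].
    exists (e * n); rewrite DxE !tofracM [tofrac d * _]mulrC -mulrA;
      congr (_ * _).
    by rewrite mulrCA mulfV ?t0 ?mulr1.
  by exists (d * a); rewrite !tofracM -mulrA aE.
have eD a : exists a', tofrac e * D (tofrac a) = tofrac a'.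
  apply: (generation_ind s_gen
    (P := [set a | exists a', tofrac e * D (tofrac a) = tofrac a'])) => //.
  - by exists 0; rewrite DB // mulr0 tofrac0.
  - move=> l u v [u' u'E] [v' v'E]; exists (l%:A * u' + v').
    by rewrite tofracD DD DZ mulrDr v'E mulrCA u'E tofracD tofracM.
  - move=> u v [u' u'E] [v' v'E]; exists (u' * v + u * v').
    by rewrite tofracM DM mulrDr mulrA u'E mulrCA v'E tofracD !tofracM.
pose E a := projT1 (cid (eD a)).
have EE a : tofrac (E a) = tofrac e * D (tofrac a) by rewrite /E; case: cid.
have tinj : injective (@tofrac A) by move=> x y /eqP; rewrite tofrac_eq => /eqP.
have El : linear E.
  move=> l u v; apply: tinj; rewrite EE tofracD DD DZ mulrDr -EE mulrCA -EE.
  by rewrite -tofracM mulr_algl tofracD.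
have EM x y : E (x * y) = E x * y + x * E y.
  by apply: tinj; rewrite EE tofracM DM tofracD !tofracM !EE; ring.
exists (@Derivation k A (linear_of El) EM) => [b bB|] /=; rewrite /linear_of_fun.
  by apply: tinj; rewrite EE DB // mulr0 tofrac0.
by rewrite -tofrac_eq0 EE mulf_neq0 ?t0.
Qed.

End FirstIntegrals.

(** * Dimensions over the prime field *)

Section Bases.
Variables (F : fieldType) (V : lmodType F).

Lemma lin_indep_extend n (e : 'I_n -> V) x :
  lin_indep e -> (forall c : 'I_n -> F, x <> \sum_i c i *: e i) ->
  lin_indep (fun i : 'I_n.+1 => oapp e x (unlift ord0 i)).
Proof.
move=> indep_e nx c; rewrite big_ord_recl unlift_none /=.
under eq_bigr => i _ do rewrite liftK /=.
move=> c0; have cz : c ord0 = 0.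
  apply/eqP; apply: contraT => cn0;
    case: (nx (fun i => - (c ord0)^-1 * c (lift ord0 i))).
  under eq_bigr => i _ do rewrite -scalerA.
  rewrite -scaler_sumr; move/eqP: c0; rewrite addrC addr_eq0 => /eqP ->.
  by rewrite scaleNr scalerN opprK scalerA mulVf // scale1r.
move: c0; rewrite cz scale0r add0r => /indep_e h i.
by case: (unliftP ord0 i) => [j ->|-> //]; apply: h.
Qed.

Lemma bounded_has_dim N :
  (forall n (e : 'I_n -> V), lin_indep e -> (n <= N)%N) -> exists n, has_dim V n.
Proof.
move=> bound; pose P n := `[< exists e : 'I_n -> V, lin_indep e >].
have P0 : exists n, P n.
  by exists 0%N; apply/asboolP; exists (fun=> 0) => c _ [].
have PN n : P n -> (n <= N)%N by move=> /asboolP[e]; apply: bound.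
case: (ex_maxnP P0 PN) => n /asboolP[e indep_e] nmax.
exists n, e; split=> // x; apply: contrapT => nx.
suff : (n < n)%N by rewrite ltnn.
apply/nmax/asboolP; exists (fun i => oapp e x (unlift ord0 i)).
by apply: lin_indep_extend => // c xE; apply: nx; exists c.
Qed.

End Bases.

Lemma has_dim_finite (F : finFieldType) (V : lmodType F) n :
  has_dim V n -> finite_set [set: V].
Proof.
move=> [e [_ span]].
have := finite_image (fun c : {ffun 'I_n -> F} => \sum_i c i *: e i)
  (finite_finset (X := [set: {ffun 'I_n -> F}])).
congr finite_set; apply/seteqP; split=> // x _.
have [c ->] := span x; exists (finfun c) => //.
by apply: eq_bigr => i _; rewrite ffunE.
Qed.

Section Comparison.
Variables (k : closedFieldType) (p : nat) (kp : p \in [pchar k]).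
Variables (A : idomainAlgType k) (B : subalgClosed A).
Hypothesis A_ft : finite_type_alg A.
Hypothesis B_normal : normal_domain (subalg B).
Hypothesis ApB : forall a : A, a ^+ p \in B.
Local Notation F_B := (derivations_vanishing_on B).
Local Notation kerB := (pic_ker (subalg_incl B)).

Let p_prime : prime p := pcharf_prime kp.

Lemma first_integral_mem (f : A) : (forall D, F_B D -> D f = 0) -> f \in B.
Proof.
move=> Df; apply: contraT => fB.
have [D DB] := ex_vanishing_derivation kp A_ft B_normal ApB fB.
by rewrite Df // eqxx.
Qed.

Lemma Fp_scale_nat (V : zmodType) (Vp : forall x : V, x *+ p = 0)
    (x : Fp_space p_prime Vp) m : (m%:R : 'F_p) *: x = x *+ m.
Proof.
rewrite -[LHS]/((x : V) *+ ((m%:R : 'F_p) : nat)) val_Fp_nat //.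
exact: (Fp_mulrn_mod Vp).
Qed.

Lemma Fp_sum_nat (V : zmodType) (Vp : forall x : V, x *+ p = 0) n
    (e : 'I_n -> Fp_space p_prime Vp) : lin_indep e ->
  forall m : 'I_n -> nat, \sum_i (e i : V) *+ m i = 0 -> forall i, (p %| m i)%N.
Proof.
move=> indep m m0 i; rewrite (dvdn_pcharf (pchar_Fp p_prime)).
apply/eqP; apply: (indep (fun i => (m i)%:R)).
by rewrite -[RHS]m0; apply: eq_bigr => j _; rewrite Fp_scale_nat.
Qed.

(** A monomial in the f i that F_B kills lies in B, so the corresponding
    combination of the classes e i is zero. *)
Lemma indep_generators (Kp : forall x : kerB, x *+ p = 0) n
    (e : 'I_n -> Fp_space p_prime Kp) : lin_indep e ->
  exists f : 'I_n -> A,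
  [/\ forall i, f i != 0,
      forall i D, F_B D -> exists a, D (f i) = a * f i
    & forall m : 'I_n -> nat, (forall D, F_B D -> D (\prod_i f i ^+ m i) = 0) ->
        forall i, (p %| m i)%N].
Proof.
move=> indep.
have ex_f i : exists f, generates_pullback (pic_ker_val (e i)) f.
  by apply: generates_pullback_ker; case: (e i) => x /= /eqP.
pose f i := projT1 (cid (ex_f i)).
have fP i : generates_pullback (pic_ker_val (e i)) (f i) by rewrite /f; case: cid.
exists f; split=> [i|i D DB|m Dm].
- exact: generates_pullback_neq0 (fP i).
- exact: generates_pullback_der (fP i) DB.
apply: (Fp_sum_nat indep); apply: val_inj; rewrite raddf_sum raddf0.
have fB := first_integral_mem Dm.
have := generates_pullback_eq0 kp B_normal ApB (generates_pullback_sum m fP) fB.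
by move=> x0; rewrite -[RHS]x0; apply: eq_bigr => i _; rewrite raddfMn.
Qed.

Lemma Pi_class_prod (DD : set (derivation A)) n (g : 'I_n -> solution DD)
    (m : 'I_n -> nat) : exists2 h : solution DD,
  \sum_i Pi_class (g i) *+ m i = Pi_class h &
  solution_val h = \prod_i solution_val (g i) ^+ m i.
Proof.
have mulP x y (u v : {fraction A}) :
    (exists2 h : solution DD, x = Pi_class h & solution_val h = u) ->
    (exists2 h : solution DD, y = Pi_class h & solution_val h = v) ->
    exists2 h : solution DD, x + y = Pi_class h & solution_val h = u * v.
  move=> [h -> <-] [h' -> <-]; exists (sol_mul h h') => //.
  exact: Pi_addE.
have one : exists2 h : solution DD, 0 = Pi_class h & solution_val h = 1.
  by exists (sol_one DD).
apply: (big_ind2 (fun x u =>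
  exists2 h : solution DD, x = Pi_class h & solution_val h = u)).
- exact: one.
- by move=> x u y v; apply: mulP.
move=> i _; elim: (m i) => [//|q IHq]; rewrite mulrS exprS; apply: mulP => //.
by exists (g i).
Qed.

Lemma generators_dim_ge n (f : 'I_n -> A) :
  (forall i, f i != 0) ->
  (forall i D, F_B D -> exists a, D (f i) = a * f i) ->
  (forall m : 'I_n -> nat, (forall D, F_B D -> D (\prod_i f i ^+ m i) = 0) ->
     forall i, (p %| m i)%N) ->
  dim_ge (Pi_space kp F_B) n.
Proof.
move=> f0 fsol indep.
have sol i : algebraic_solution F_B (tofrac (f i)).
  split=> [|D DB]; first by rewrite tofrac_eq0.
  have [a aE] := fsol i D DB; exists a.
  by rewrite der_frac_tofrac aE tofracM mulfK // tofrac_eq0.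
pose g i : solution F_B := Solution (asboolT (sol i)).
exists (fun i => Pi_class (g i) : Pi_space kp F_B) => c c0 i.
have [h hE hv] := Pi_class_prod g (fun i => c i : nat).
have h0 : Pi_class h = Pi_class (sol_one F_B) by rewrite -hE; exact: c0.
have /Pi_classP := h0; rewrite hv /= divr1 => -[_ Dh].
have := indep (fun i => c i : nat) _ i.
have tofracE : tofrac (\prod_i f i ^+ c i) = \prod_i tofrac (f i) ^+ c i.
  by rewrite rmorph_prod; apply: eq_bigr => j _; rewrite rmorphXn.
move=> pc; have {}pc : (p %| c i)%N.
  apply: pc => D DB; apply/eqP; rewrite -tofrac_eq0 -der_frac_tofrac.
  by rewrite tofracE Dh.
apply: val_inj; move: (ltn_ord (c i));
  rewrite [X in (_ < X)%N](Fp_cast p_prime) => cp.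
move: pc; rewrite /dvdn modn_small // => /eqP; exact.
Qed.

End Comparison.

Theorem corollary1p6
    (k : closedFieldType) (p : nat) (kp : p \in [pchar k])
    (A : idomainAlgType k) (A_ft : finite_type_alg A) (A_normal : normal_domain A)
    (B : subalgClosed A) (B_normal : normal_domain (subalg B))
    (ApB : forall a : A, a ^+ p \in B) :
  (exists Kp : forall x : pic_ker (subalg_incl B), x *+ p = 0,
     finite_set [set: pic_ker (subalg_incl B)] /\
     exists n : nat,
       has_dim (Fp_space (pcharf_prime kp) Kp) n /\
       dim_ge (Pi_space kp (derivations_vanishing_on B)) n) /\
  (ufd A -> finite_set [set: pic (subalg B)]).
Proof.
pose Kp := pic_ker_pchar kp B_normal ApB.
have [s s_gen] := A_ft.
have [N boundN] := algebraic_solutions_rank_bounded kp s_gen B.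
have [n dim_n] : exists n, has_dim (Fp_space (pcharf_prime kp) Kp) n.
  apply: (bounded_has_dim (N := N)) => n e indep.
  have [f [f0 fsol fm]] := indep_generators A_ft B_normal ApB indep.
  exact: boundN f0 fsol fm.
have fin_ker : finite_set [set: pic_ker (subalg_incl B)].
  exact: (has_dim_finite dim_n).
split.
  exists Kp; split=> //; exists n; split=> //.
  have [e [indep _]] := dim_n.
  have [f [f0 fsol fm]] := indep_generators A_ft B_normal ApB indep.
  exact: generators_dim_ge f0 fsol fm.
move=> ufdA.
have pic0 x : pic_pullback (subalg_incl B) x = 0.
  rewrite -[LHS]pic_reprK; apply/pic_ofP.
  exact: (@ufd_invertible_free A ufdA _ (pic_repr_inv _)).
have := finite_image (@pic_ker_val _ _ (subalg_incl B)) fin_ker.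
congr finite_set; apply/seteqP; split=> // x _.
have xker : x \in pic_ker_pred (subalg_incl B).
  by rewrite inE pic0.
by exists (PicKer xker).
Qed.
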